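(* Let $n\ge 2$. A functional $\Psi:\mathcal{P}^n \to \mathbb{R}$ is a continuous and $\mathrm{SL}(n)$ invariant valuation if and only if there are constants $c_0, c_n, d_n\in\mathbb{R}$ such that $$\Psi (P)= c_0\,V_0(P) + c_n\,V_n(P)+ d_n\,V_n([0,P])$$ for every $P\in\mathcal{P}^n$.
   Context: $\mathcal{P}^n$ is the set of (nonempty) convex polytopes in $\mathbb{R}^n$, equipped with the topology induced by the Hausdorff metric (continuity refers to this topology). A functional $\Psi:\mathcal{S}\to\mathbb{R}$ on a collection $\mathcal{S}$ of sets is a valuation if $\Psi(P)+\Psi(Q)=\Psi(P\cup Q)+\Psi(P\cap Q)$ whenever $P,Q,P\cap Q,P\cup Q\in\mathcal{S}$. It is $\mathrm{SL}(n)$ invariant if $\Psi(AP)=\Psi(P)$ for every $A\in\mathrm{SL}(n)$ (the real $n\times n$ matrices of determinant $1$) and $P\in\mathcal{S}$. $V_n$ is $n$-dimensional volume and $V_0$ is the Euler characteristic, i.e. $V_0(P)=1$ for every nonempty polytope $P$. $[0,P]$ is the convex hull of the origin $0$ and $P$. *)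

(* Defs.v *)
From HB Require Import structures.
From mathcomp Require Import all_boot all_order all_algebra.
From mathcomp Require Import all_classical all_reals all_analysis.
From mathcomp Require Import ring lra.

Set Implicit Arguments.
Unset Strict Implicit.
Unset Printing Implicit Defensive.

Import Order.TTheory GRing.Theory Num.Theory.
Import numFieldNormedType.Exports.

Local Open Scope classical_set_scope.
Local Open Scope ring_scope.

Section ConvexHull.
Variables (R : realType) (V : lmodType R).
Implicit Types A B C : set V.

Definition conv_hull A : set V := smallest (@convex_set R V) A.

Lemma convex_setP C : @convex_set R V C <->
  forall x y t, C x -> C y -> 0 <= t <= 1 -> C (t *: x + (1 - t) *: y).
Proof.
split=> [cC x y t Cx Cy t01|cC x y t].
  have /itvP t01' : t \in `[0, 1] by rewrite in_itv.
  have := cC x y (@Itv01 _ t (proj1 (andP t01)) (proj2 (andP t01))).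
  by rewrite !inE => /(_ Cx Cy).
rewrite !inE => Cx Cy; apply: cC => //.
by rewrite ge0 le1.
Qed.

Lemma conv_hull_convex A : @convex_set R V (conv_hull A).
Proof.
apply/convex_setP => x y t Ax Ay t01 C /= [cC AC].
by move/convex_setP: (cC); apply => //; [exact: Ax|exact: Ay].
Qed.

Lemma sub_conv_hull A : A `<=` conv_hull A.
Proof. exact: sub_smallest. Qed.

Lemma conv_hull_sub A C : @convex_set R V C -> A `<=` C -> conv_hull A `<=` C.
Proof. by move=> cC AC x; apply. Qed.

Lemma conv_hull1 a : conv_hull [set a] = [set a].
Proof.
apply/seteqP; split; last exact: sub_conv_hull.
apply: conv_hull_sub => //; apply/convex_setP => x y t /= -> -> _.
by rewrite -scalerDl addrCA subrr addr0 scale1r.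
Qed.

Lemma conv_hull_setU1 a A : A !=set0 ->
  conv_hull (a |` A) =
  [set p.1 *: a + (1 - p.1) *: p.2 | p in `[0, 1] `*` conv_hull A].
Proof.
move=> [a0 Aa0]; apply/seteqP; split; last first.
  move=> _ [[t y] [/= + Ay] <-]; rewrite in_itv/= => t01.
  move/convex_setP: (@conv_hull_convex (a |` A)); apply => //.
    by apply: sub_conv_hull; left.
  apply: conv_hull_sub Ay; first exact: conv_hull_convex.
  by move=> z Az; apply: sub_conv_hull; right.
apply: conv_hull_sub; last first.
  move=> z [->|Az].
    exists ((1 : R), a0); last by rewrite /= scale1r subrr scale0r addr0.
    by split; [rewrite /= in_itv/= ler01 lexx|exact: sub_conv_hull].
  exists ((0 : R), z); last by rewrite /= scale0r subr0 scale1r add0r.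
  by split; [rewrite /= in_itv/= ler01 lexx|exact: sub_conv_hull].
apply/convex_setP => _ _ l [[t y] [/= + Ay] <-] [[s z] [/= + Az] <-].
rewrite !in_itv/= => t01 s01 l01.
pose T := l * t + (1 - l) * s.
have T01 : 0 <= T <= 1 by rewrite /T; apply/andP; split; nra.
have [T1|T1] := eqVneq T 1.
  have e1 : l * (1 - t) = 0 by rewrite /T in T1; nra.
  have e2 : (1 - l) * (1 - s) = 0 by rewrite /T in T1; nra.
  exists (1, y); first by split => //=; rewrite in_itv/= ler01 lexx.
  rewrite /= subrr scale0r addr0 !scalerDr !scalerA e1 e2 !scale0r !addr0.
  by rewrite -scalerDl -/T T1.
have u0 : 0 < 1 - T by rewrite subr_gt0 lt_neqAle T1; case/andP: T01.
pose m := l * (1 - t) / (1 - T).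
have m1 : 1 - m = (1 - l) * (1 - s) / (1 - T).
  by rewrite /m /T; field; rewrite gt_eqF.
exists (T, m *: y + (1 - m) *: z).
  split; first by rewrite /= in_itv.
  move/convex_setP: (@conv_hull_convex A); apply => //=.
  rewrite -[m <= 1]subr_ge0 m1 /m !divr_ge0 ?mulr_ge0 ?(ltW u0)//; lra.
rewrite /= scalerDr !scalerA m1 /m mulrC divfK ?gt_eqF//.
rewrite [(1 - T) * _]mulrC divfK ?gt_eqF//.
by rewrite !scalerDr !scalerA addrACA -scalerDl -/T.
Qed.

End ConvexHull.

Lemma conv_hull_image (R : realType) (U V : lmodType R) (f : {linear U -> V})
  (A : set U) : conv_hull (f @` A) = f @` conv_hull A.
Proof.
apply/seteqP; split.
  apply: conv_hull_sub; last by apply: image_subset; exact: sub_conv_hull.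
  apply/convex_setP => _ _ t [x Ax <-] [y Ay <-] t01.
  exists (t *: x + (1 - t) *: y); last by rewrite linearD !linearZ.
  by move/convex_setP: (@conv_hull_convex _ _ A); apply.
move=> _ [x Ax <-].
apply: (@conv_hull_sub _ _ _ (f @^-1` conv_hull (f @` A))) Ax.
  apply/convex_setP => y z t /= Ay Az t01; rewrite linearD !linearZ.
  by move/convex_setP: (@conv_hull_convex _ _ (f @` A)); apply.
by move=> y Ay; apply: sub_conv_hull; exists y.
Qed.

Section EuclideanNorm.
Variables (R : realType) (n : nat).
Implicit Types x y : 'cV[R]_n.

Definition enorm x : R := Num.sqrt (\sum_i x i 0 ^+ 2).

Lemma sum_sqr_ge0 x : 0 <= \sum_i x i 0 ^+ 2.
Proof. by apply: sumr_ge0 => i _; exact: sqr_ge0. Qed.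

Lemma enorm_ge0 x : 0 <= enorm x.
Proof. exact: sqrtr_ge0. Qed.

Lemma enorm0 : enorm 0 = 0.
Proof. by rewrite /enorm big1 ?sqrtr0// => i _; rewrite mxE expr0n. Qed.

Lemma enormN x : enorm (- x) = enorm x.
Proof. by congr Num.sqrt; apply: eq_bigr => i _; rewrite mxE sqrrN. Qed.

Lemma enormBC x y : enorm (x - y) = enorm (y - x).
Proof. by rewrite -enormN opprB. Qed.

Lemma le_coord_enorm x i : `|x i 0| <= enorm x.
Proof.
rewrite -sqrtr_sqr ler_wsqrtr// (bigD1 i)//= lerDl.
by apply: sumr_ge0 => j _; exact: sqr_ge0.
Qed.

Lemma cauchy_schwarz x y : \sum_i x i 0 * y i 0 <= enorm x * enorm y.
Proof.
rewrite /enorm -sqrtrM ?sum_sqr_ge0//.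
rewrite (le_trans (ler_norm _))// -sqrtr_sqr ler_wsqrtr//.
have : 0 <= \sum_i \sum_j (x i 0 * y j 0 - x j 0 * y i 0) ^+ 2.
  by apply: sumr_ge0 => i _; apply: sumr_ge0 => j _; exact: sqr_ge0.
have -> : \sum_i \sum_j (x i 0 * y j 0 - x j 0 * y i 0) ^+ 2 =
    \sum_i \sum_j (x i 0 ^+ 2 * y j 0 ^+ 2)
    + \sum_i \sum_j (y i 0 ^+ 2 * x j 0 ^+ 2)
    - 2 * (\sum_i \sum_j ((x i 0 * y i 0) * (x j 0 * y j 0))).
  rewrite mulr_sumr -big_split -sumrB/=; apply: eq_bigr => i _.
  rewrite mulr_sumr -big_split -sumrB/=; apply: eq_bigr => j _; ring.
rewrite -!big_distrlr/= expr2; nra.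
Qed.

Lemma ler_enormD x y : enorm (x + y) <= enorm x + enorm y.
Proof.
rewrite -(@ler_pXn2r _ 2) ?nnegrE ?addr_ge0 ?enorm_ge0//.
have sq z : enorm z ^+ 2 = \sum_i z i 0 ^+ 2 by rewrite sqr_sqrtr ?sum_sqr_ge0.
have -> : enorm (x + y) ^+ 2 =
    enorm x ^+ 2 + enorm y ^+ 2 + 2 * \sum_i x i 0 * y i 0.
  rewrite !sq mulr_sumr -!big_split/=; apply: eq_bigr => i _; rewrite mxE; ring.
have := cauchy_schwarz x y; nra.
Qed.

End EuclideanNorm.

Section HausdorffDistance.
Variables (R : realType) (n : nat).
Implicit Types A B : set 'cV[R]_n.

Definition dist_to A (x : 'cV[R]_n) : R := inf [set enorm (x - y) | y in A].

Definition hausdorff_dist A B : R :=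
  Num.max (sup [set dist_to B x | x in A]) (sup [set dist_to A y | y in B]).

End HausdorffDistance.

(* A polytope is nonempty: it is the hull of a nonempty finite set *)
Record polytope (R : realType) (n : nat) := Polytope {
  polytope_set :> set 'cV[R]_n ;
  polytopeP : exists F : set 'cV[R]_n,
    [/\ finite_set F, F !=set0 & polytope_set = conv_hull F] }.

Section PolytopeTheory.
Variables (R : realType) (n : nat).
Implicit Types P Q S : polytope R n.

Lemma polytope_inj P Q : P = Q :> set 'cV[R]_n -> P = Q.
Proof.
by case: P Q => [A pA] [B pB] /= E; case: _ / E pB => pB; congr Polytope.
Qed.

Lemma polytope_neq0 P : (P : set 'cV[R]_n) !=set0.
Proof.
have [F [_ [x Fx] ->]] := polytopeP P; exists x; exact: sub_conv_hull.
Qed.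

Lemma compact_conv_hull (s : seq 'cV[R]_n) :
  compact (conv_hull [set` s] : set 'cV[R]_n).
Proof.
elim: s => [|a s IHs].
  rewrite set_nil (_ : conv_hull _ = set0); first exact: compact0.
  by apply/seteqP; split => //; apply: conv_hull_sub => // x y t; rewrite inE.
have -> : [set` a :: s] = a |` [set` s].
  by apply/seteqP; split=> x /=; rewrite inE => /predU1P.
have [->|/set0P s0] := eqVneq [set` s] set0.
  by rewrite setU0 conv_hull1; exact: compact_set1.
rewrite conv_hull_setU1//; apply: continuous_compact.
  apply: continuous_subspaceT => -[t y].
  apply: cvgD; apply: cvgZ.
  - exact: cvg_fst.
  - exact: cvg_cst.
  - by apply: cvgB; [exact: cvg_cst|exact: cvg_fst].
  - exact: cvg_snd.
by apply: compact_setX => //; exact: segment_compact.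
Qed.

Lemma compact_polytope P : compact (P : set 'cV[R]_n).
Proof.
have [F [/finite_seqP[s ->] _ ->]] := polytopeP P; exact: compact_conv_hull.
Qed.

Lemma polytope_enorm_bounded P :
  exists M, forall x, polytope_set P x -> enorm x <= M.
Proof.
have [N [_ PN]] := compact_bounded (@compact_polytope P).
exists (Num.sqrt (\sum_(i < n) (`|N| + 1) ^+ 2)) => x Px.
rewrite ler_wsqrtr//; apply: ler_sum => i _.
rewrite -[leLHS]real_normK ?num_real// lerXn2r ?nnegrE ?addr_ge0//.
have /(_ x Px) := PN (`|N| + 1) (ltr_pwDr ltr01 (ler_norm N)).
apply: le_trans; rewrite /Num.norm/= mx_normrE.
exact: (le_bigmax _ (fun ij => `|x ij.1 ij.2|) (i, 0)).
Qed.

Let dists P x := [set enorm (x - y) | y in (P : set 'cV[R]_n)].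

Lemma dist_to_has_inf P x : has_inf (dists P x).
Proof.
split; last by exists 0 => _ [y _ <-]; exact: enorm_ge0.
by have [y Py] := polytope_neq0 P; exists (enorm (x - y)), y.
Qed.

Lemma dist_to_ge0 P x : 0 <= dist_to P x.
Proof.
apply: lb_le_inf; first by case: (dist_to_has_inf P x).
by move=> _ [y _ <-]; exact: enorm_ge0.
Qed.

Lemma dist_to_le P x y : polytope_set P y -> dist_to P x <= enorm (x - y).
Proof.
by move=> Py; apply: ge_inf; [case: (dist_to_has_inf P x)|exists y].
Qed.

Lemma dist_to_lt P x e : dist_to P x < e ->
  exists2 y, polytope_set P y & enorm (x - y) < e.
Proof.
by move=> /inf_lt[|_ [y Py <-] ?]; [case: (dist_to_has_inf P x)|exists y].
Qed.

Lemma dist_to_sup P Q x : polytope_set P x -> dist_to Q x <= sup [set dist_to Q x | x in P].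
Proof.
move=> Px; apply: ub_le_sup; last by exists x.
have [M PM] := polytope_enorm_bounded P; have [y Qy] := polytope_neq0 Q.
exists (M + enorm y) => _ [z Pz <-].
rewrite (le_trans (dist_to_le _ Qy))// (le_trans (ler_enormD _ _))// enormN.
by rewrite lerD2r PM.
Qed.

Lemma hausdorff_distP P Q e : hausdorff_dist P Q <= e <->
  (forall x, polytope_set P x -> dist_to Q x <= e) /\ (forall y, polytope_set Q y -> dist_to P y <= e).
Proof.
rewrite /hausdorff_dist ge_max; split=> [/andP[PQ QP]|[PQ QP]].
  by split=> x Hx; [apply: le_trans PQ|apply: le_trans QP];
    exact: dist_to_sup.
apply/andP; split; apply: ge_sup.
- by have [x Px] := polytope_neq0 P; exists (dist_to Q x), x.
- by move=> _ [x Px <-]; exact: PQ.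
- by have [x Qx] := polytope_neq0 Q; exists (dist_to P x), x.
- by move=> _ [x Qx <-]; exact: QP.
Qed.

Lemma hausdorff_dist_sym P Q : hausdorff_dist P Q = hausdorff_dist Q P.
Proof. exact: maxC. Qed.

Lemma dist_to_eq0 P x : dist_to P x = 0 <-> polytope_set P x.
Proof.
split=> [d0|Px]; last first.
  apply/eqP; rewrite eq_le dist_to_ge0 andbT.
  by rewrite (le_trans (dist_to_le _ Px))// subrr enorm0.
have /closure_id -> : closed (P : set 'cV[R]_n).
  by apply: compact_closed; [exact: norm_hausdorff|exact: compact_polytope].
move=> B /nbhs_ballP[e/= e0 eB].
have [|y Py xy] := @dist_to_lt P x e; first by rewrite d0.
exists y; split => //; apply: eB; split => // i j.
rewrite /ball/= ord1 (le_lt_trans _ xy)//.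
by have := le_coord_enorm (x - y) i; rewrite !mxE.
Qed.

Lemma dist_to_triangle P Q x :
  dist_to Q x <= dist_to P x + hausdorff_dist P Q.
Proof.
rewrite -lerBlDr; apply: lb_le_inf; first by case: (dist_to_has_inf P x).
move=> _ [y Py <-]; rewrite lerBlDr; apply/ler_addgt0Pr => e e0.
have [|z Qz yz] := @dist_to_lt Q y (hausdorff_dist P Q + e).
  rewrite (@le_lt_trans _ _ (hausdorff_dist P Q)) ?ltrDl//.
  by have [+ _] := (hausdorff_distP P Q _).1 (lexx _); apply.
rewrite (le_trans (dist_to_le _ Qz))// -(subrKA y) (le_trans (ler_enormD _ _))//.
by rewrite -addrA lerD2l ltW.
Qed.

Lemma hausdorff_distxx P : hausdorff_dist P P = 0.
Proof.
apply/eqP; rewrite eq_le; apply/andP; split.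
  by apply/hausdorff_distP; split=> x /dist_to_eq0 ->.
have [x Px] := polytope_neq0 P.
have [+ _] := (hausdorff_distP P P _).1 (lexx _).
by move=> /(_ x Px); rewrite (dist_to_eq0 P x).2.
Qed.

Lemma hausdorff_dist_positivity P Q : hausdorff_dist P Q = 0 -> P = Q.
Proof.
move=> PQ0; have [] := (hausdorff_distP P Q 0).1; first by rewrite PQ0.
move=> PQ QP; apply: polytope_inj; apply/seteqP; split => x Hx;
  by apply/dist_to_eq0/eqP; rewrite eq_le dist_to_ge0 andbT ?PQ ?QP.
Qed.

Lemma hausdorff_dist_triangle Q P S :
  hausdorff_dist P S <= hausdorff_dist P Q + hausdorff_dist Q S.
Proof.
have H (A B C : polytope R n) x : polytope_set A x ->
    dist_to C x <= hausdorff_dist A B + hausdorff_dist B C.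
  move=> Ax; rewrite (le_trans (dist_to_triangle B C x))// lerD2r.
  by have [+ _] := (hausdorff_distP A B _).1 (lexx _); apply.
apply/hausdorff_distP; split=> x Hx; first exact: H.
by rewrite addrC (hausdorff_dist_sym P) (hausdorff_dist_sym Q); exact: H.
Qed.

HB.instance Definition _ := gen_eqMixin (polytope R n).
HB.instance Definition _ := gen_choiceMixin (polytope R n).
HB.instance Definition _ := @isMetric.Build R (polytope R n)
  (@hausdorff_dist R n) hausdorff_distxx hausdorff_dist_positivity
  hausdorff_dist_sym hausdorff_dist_triangle.

Lemma polytope_mulmx_subproof (A : 'M[R]_n) P :
  exists F : set 'cV[R]_n,
    [/\ finite_set F, F !=set0 & mulmx A @` P = conv_hull F].
Proof.
have [F [finF [x Fx] ->]] := polytopeP P; exists (mulmx A @` F); split.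
- exact: finite_image.
- by exists (A *m x), x.
- by rewrite conv_hull_image.
Qed.

Definition polytope_mulmx (A : 'M[R]_n) P : polytope R n :=
  Polytope (polytope_mulmx_subproof A P).

End PolytopeTheory.

(* Iterated integral of the indicator of A over the coordinates: on Borel sets
   this is the n-fold product of the Lebesgue measure of R *)
Fixpoint lebesgue_volume (R : realType) (n : nat) :
    set 'cV[R]_n -> \bar R :=
  match n with
  | 0 => fun A => (\1_A (0 : 'cV[R]_0))%:E
  | m.+1 => fun A => (\int[@lebesgue_measure R]_t
      lebesgue_volume [set y : 'cV[R]_m |
        A (col_mx (t : R)%:M y : 'cV[R]_(1 + m))])%E
  end.

Section Functionals.
Variables (R : realType) (n : nat).

(* The Euler characteristic: constantly 1 because polytopes are nonempty *)
Definition V_0 (P : polytope R n) : R := 1.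

Definition V_n (A : set 'cV[R]_n) : R := fine (lebesgue_volume A).

Definition is_valuation (Psi : polytope R n -> R) :=
  forall P Q U I : polytope R n,
    U = P `|` Q :> set 'cV[R]_n -> I = P `&` Q :> set 'cV[R]_n ->
    Psi P + Psi Q = Psi U + Psi I.

Definition SL_invariant (Psi : polytope R n -> R) :=
  forall (A : 'M[R]_n) (P : polytope R n),
    \det A = 1 -> Psi (polytope_mulmx A P) = Psi P.

End Functionals.

(* Main.v *)
(* "If": volume is a Borel measure on R^n, it is invariant under shears by Fubini and
   hence under SL(n), and adding a segment of length 2e to a convex body in a box of
   half-width M adds at most 2e(2M)^(n-1), so volume is Lipschitz for the Hausdorff
   distance on bounded sets.  If P u Q is convex, every segment from P to Q meets
   P n Q, so P |-> [0,P] respects unions and intersections.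

   "Only if": let s be a linearly independent list.  If it has less than n elements,
   SL(n) shrinks conv(s) and conv(0,s) to 0, so Psi takes the value Psi({0}) there.
   If it has n elements, the values only depend on |det s|, and cutting the simplex by
   a hyperplane through 0 gives Cauchy's functional equation, so that both are affine
   in |det s|.  Subtracting a combination of V_0, V_n and V_n([0,.]) leaves a valuation
   Phi vanishing on all these simplices.  Cutting along edges whose endpoints have
   barycentric coordinates of the same sign for the origin extends this to all
   simplices, and cutting along Radon-type dependences to conv(v,S) for S a simplex
   and v in its affine hull.  Hence Phi([v,.]) is again a valuation vanishing on all
   simplices, and induction on the number of points gives Phi = 0. *)

Require Import Defs.
From HB Require Import structures.
From mathcomp Require Import all_boot all_order all_algebra.
From mathcomp Require Import all_classical all_reals all_analysis.
From mathcomp Require Import measurable_realfun.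
From mathcomp Require Import ring lra.

Set Implicit Arguments.
Unset Strict Implicit.
Unset Printing Implicit Defensive.

Import Order.TTheory GRing.Theory Num.Theory.
Import numFieldNormedType.Exports.

Local Open Scope classical_set_scope.
Local Open Scope ring_scope.

(** * The iterated integral as a measure *)

Section VolumeMeasure.
Variable R : realType.

(** The valuation identity is available only for pairs with convex union, which rules out direct
    inclusion-exclusion over a triangulation. Every cut is therefore by a hyperplane containing all
    but two of the given points: both pieces and their intersection are then hulls of explicit lists
    again. Since translations are not among the symmetries, the position of the origin matters.
    Linearly independent lists are classified up to SL(n) by their determinant, but a simplex with
    the origin in its affine hull and not among its vertices has no such normal form, so it is
    reached only by cutting. The families conv(s) and conv(0,s) give two independent slopes in |det
    s|, which is why two volume terms appear. These two cases decide whether vanishing on simplices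
    passes from Phi to Phi([v,.]). In this direction continuity of Psi serves two limits: shrinking
    to the origin, and the regularity near 0 that makes solutions of Cauchy's equation linear. *)

Definition cylinder n : set (set 'cV[R]_n) :=
  [set A | exists (i : 'I_n) (B : set (measurableTypeR R)),
    measurable B /\ A = [set x : 'cV[R]_n | B (x i 0)]].

Local Notation mcV n := (g_sigma_algebraType (@cylinder n)).

Lemma measurable_coord n (i : 'I_n) :
  measurable_fun setT (fun x : mcV n => (x : 'cV[R]_n) i 0 : measurableTypeR R).
Proof.
move=> _ B mB; rewrite setTI; apply: sub_sigma_algebra; exists i, B; split=> //.
Qed.

Lemma measurable_fun_mcV d (T : measurableType d) n (f : T -> mcV n) :
  (forall i, measurable_fun setT
     (fun t => (f t : 'cV[R]_n) i 0 : measurableTypeR R)) ->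
  measurable_fun setT f.
Proof.
move=> mf; apply: measurability => //.
move=> _ [_ [i [B [mB ->]]] <-].
by have := mf i measurableT B mB.
Qed.

Lemma measurable_col_mx n :
  measurable_fun setT (fun p : measurableTypeR R * mcV n =>
     col_mx p.1%:M p.2 : mcV (1 + n)).
Proof.
apply: measurable_fun_mcV => i.
case: (split_ordP i) => j ->.
  rewrite (_ : (fun _ => _) = fst); last first.
    by apply/funext => p; rewrite col_mxEu ord1 mxE eqxx mulr1n.
  exact: measurable_fst.
rewrite (_ : (fun _ => _) =
  (fun x : mcV n => (x : 'cV[R]_n) j 0 : measurableTypeR R) \o snd); last first.
  by apply/funext => p; rewrite /= col_mxEd.
by apply: measurableT_comp; [exact: measurable_coord|exact: measurable_snd].
Qed.

Definition box n (a b : R) : set 'cV[R]_n := [set x | forall i, a <= x i 0 <= b].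

Lemma box_section n a b (t : R) :
  [set y : 'cV[R]_n | box a b (col_mx t%:M y : 'cV_(1 + n))] =
  if a <= t <= b then box a b else set0.
Proof.
have ct (y : 'cV[R]_n) : (col_mx t%:M y : 'cV_(1 + n)) (lshift n ord0) 0 = t.
  by rewrite col_mxEu mxE eqxx mulr1n.
case: ifPn => [tab|/negP tab]; last first.
  by apply/seteqP; split => // y /= /(_ (lshift n ord0)); rewrite ct => /tab.
apply/seteqP; split => y /= H i; first by have := H (rshift 1 i); rewrite col_mxEd.
by case: (split_ordP i) => j ->; rewrite ?ord1 ?ct// col_mxEd.
Qed.

Lemma lebesgue_volume_ge0 n (A : set 'cV[R]_n) : (0 <= lebesgue_volume A)%E.
Proof.
elim: n A => [|n IH] A /=; first by rewrite lee_fin indicE.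
by apply: integral_ge0 => t _; exact: IH.
Qed.

Lemma lebesgue_volume0 n : lebesgue_volume (set0 : set 'cV[R]_n) = 0%E.
Proof.
elim: n => [|n IH] /=; first by rewrite indicE in_set0.
by under eq_integral do rewrite IH; rewrite integral0.
Qed.

Lemma lebesgue_volume_box n a b : a <= b ->
  lebesgue_volume (box a b : set 'cV[R]_n) = ((b - a) ^+ n)%:E.
Proof.
move=> ab; elim: n => [|n IH] /=.
  by rewrite indicE mem_set//= => -[].
under eq_integral do rewrite box_section.
rewrite (eq_integral (fun t : measurableTypeR R => ((b - a) ^+ n * \1_(`[a, b]%classic) t)%:E)); last first.
  move=> t _; rewrite indicE.
  rewrite [t \in _](_ : _ = (a <= t <= b)); last first.
    by apply/idP/idP; rewrite inE /= in_itv.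
  by case: ifP => _; rewrite ?IH ?mulr1// lebesgue_volume0 mulr0.
under eq_integral do rewrite EFinM.
rewrite ge0_integralZl_EFin//; last 2 first.
  by apply/measurable_EFinP; exact: measurable_indic.
  by rewrite exprn_ge0// subr_ge0.
rewrite integral_indic// setIT /= lebesgue_measure_itv/= lte_fin.
rewrite exprSr; move: ab; rewrite le_eqVlt => /predU1P[->|->].
  by rewrite ltxx subrr mule0 mulr0.
by rewrite -EFinD -EFinM.
Qed.

Lemma measurable_cylinders n (B : 'I_n -> set (measurableTypeR R)) :
  (forall i, measurable (B i)) ->
  measurable ([set x : 'cV[R]_n | forall i, B i (x i 0)] : set (mcV n)).
Proof.
move=> mB; rewrite (_ : mkset _ = ~` \bigcup_i ~` [set x : 'cV[R]_n | B i (x i 0)]).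
  apply: measurableC; apply: countable_bigcupT_measurable => [|i]; first exact: countableP.
  apply: measurableC.
  by have := @measurable_coord n i measurableT _ (mB i); rewrite setTI.
rewrite setC_bigcup; apply/seteqP; split => x /= H i; first by move=> _; rewrite setCK.
by have := H i I; rewrite setCK.
Qed.

Lemma measurable_box n a b : measurable (box a b : set (mcV n)).
Proof.
rewrite (_ : box a b = [set x : 'cV[R]_n | forall i, `[a, b]%classic (x i 0)]).
  by apply: (@measurable_cylinders n (fun=> `[a, b]%classic)) => _; exact: measurable_itv.
by apply/seteqP; split => x /= + i => /(_ i); rewrite in_itv.
Qed.

(** An open set is the union of the balls inside it with rational centre and radius [m.+1%:R^-1].
    There are countably many, and for the maximum norm each is a finite intersection of
    cylinders. *)
Lemma open_measurable_mcV n (U : set 'cV[R]_n) :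
  open U -> measurable (U : set (mcV n)).
Proof.
move=> oU.
pose qv (q : 'cV[rat]_n) : 'cV[R]_n := map_mx ratr q.
pose F (p : 'cV[rat]_n * nat) : set 'cV[R]_n :=
  if pselect (ball (qv p.1) (p.2.+1%:R^-1) `<=` U) is left _
  then ball (qv p.1) (p.2.+1%:R^-1) else set0.
have -> : U = \bigcup_p F p.
  apply/seteqP; split => [x Ux|x [p _]]; last first.
    by rewrite /F; case: pselect => // H /H.
  have /nbhs_ballP[e /= e0 eU] : nbhs x U by exact: open_nbhs_nbhs.
  have [m me] : exists m : nat, m.+1%:R^-1 < e / 2.
    have e20 : 0 < e / 2 by rewrite divr_gt0.
    by have [m _ /(_ m (leqnn m)) ?] := near_infty_natSinv_lt (PosNum e20); exists m.
  have m0 : 0 < m.+1%:R^-1 :> R by rewrite invr_gt0.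
  have /choice[q qx] : forall i, exists q : rat, `|ratr q - x i 0| < m.+1%:R^-1 :> R.
    move=> i; have [|q] := @rat_in_itvoo R (x i 0) (x i 0 + m.+1%:R^-1); first by rewrite ltrDl.
    rewrite in_itv/= => /andP[? ?];
    by exists q; rewrite ger0_norm ?subr_ge0 1?ltW// ltrBlDl.
  pose Q : 'cV[rat]_n := \col_i q i.
  have xQ : ball (qv Q) (m.+1%:R^-1) x.
    by split => // i j; rewrite /ball/= !mxE ord1.
  exists (Q, m) => //; rewrite /F/=; case: pselect => // -[] y Qy; apply: eU.
  apply: (@le_ball _ _ _ (m.+1%:R^-1 + m.+1%:R^-1)).
    by rewrite [e]splitr lerD// ltW.
  by apply: ball_triangle Qy; apply: ball_sym.
apply: countable_bigcupT_measurable => // -[q m]; rewrite /F; case: pselect => // _.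
rewrite (_ : ball _ _ = [set x : 'cV[R]_n | forall i,
   (ball (qv q i 0) m.+1%:R^-1 : set (measurableTypeR R)) (x i 0)]).
  apply: (@measurable_cylinders n (fun i => ball (qv q i 0) _)) => i.
  by apply: open_measurable; exact: ball_open.
apply/seteqP; split => x.
  by case=> _ H i /=; exact: H.
by move=> H; split => [//|i j]; rewrite ord1; exact: H.
Qed.

Lemma closed_measurable_mcV n (U : set 'cV[R]_n) :
  closed U -> measurable (U : set (mcV n)).
Proof.
by move=> /closed_openC/open_measurable_mcV/measurableC; rewrite setCK.
Qed.

Lemma compact_measurable_mcV n (U : set 'cV[R]_n) :
  compact U -> measurable (U : set (mcV n)).
Proof.
by move=> cU; apply: closed_measurable_mcV; apply: compact_closed cU; exact: norm_hausdorff.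
Qed.

Lemma lebesgue_volume_sigma_finite n :
  sigma_finite setT (@lebesgue_volume R n : set (mcV n) -> \bar R).
Proof.
exists (fun k => box (- k%:R) k%:R).
  apply/esym/seteqP; split => // x _.
  have [k xk] : exists k : nat, \sum_i `|x i 0| < k%:R.
    by have := Num.Theory.archi_boundP; eexists; apply: archi_boundP; exact: sumr_ge0.
  exists k => // i; rewrite -ler_norml (le_trans _ (ltW xk))//.
  by rewrite (bigD1 i)//= lerDl sumr_ge0.
by move=> k; split; [exact: measurable_box|rewrite lebesgue_volume_box ?ltry//; rewrite -subr_ge0 opprK addr_ge0].
Qed.

(** The induction hypothesis is what makes the volume in dimension [n] a measure, so the product
    measure can only be formed inside the induction. The volume one dimension up is its push-forward
    along [col_mx]. *)
Lemma lebesgue_volume_sigma_additive n :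
  semi_sigma_additive (@lebesgue_volume R n : set (mcV n) -> \bar R).
Proof.
elim: n => [|n IH]; first exact: (@measure_semi_sigma_additive _ _ _ (dirac (0 : mcV 0))).
pose c := isMeasure.Build _ (mcV n) R (@lebesgue_volume R n)
  (lebesgue_volume0 n) (@lebesgue_volume_ge0 n) IH.
pose c' : {measure set (mcV n) -> \bar R} := HB.pack (@lebesgue_volume R n) c.
pose mu : {sigma_finite_measure set (mcV n) -> \bar R} :=
  HB.pack (Measure.sort c') (@Measure_isSigmaFinite.Build _ _ _ c' (lebesgue_volume_sigma_finite n)).
pose phi (p : measurableTypeR R * mcV n) : mcV n.+1 := col_mx p.1%:M p.2 : 'cV_(1 + n).
have E : (@lebesgue_volume R n.+1 : set (mcV n.+1) -> \bar R) =
    pushforward (lebesgue_measure \x mu)%E phi.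
  apply/funext => A; rewrite /pushforward/= /product_measure1.
  apply: eq_integral => t _ /=; congr lebesgue_volume.
  by apply/seteqP; split => y; rewrite /xsection /= inE.
pose phi' : {mfun (measurableTypeR R * mcV n)%type >-> mcV n.+1} :=
  HB.pack phi (isMeasurableFun.Build _ _ _ _ phi (@measurable_col_mx n)).
rewrite E.
exact: (@measure_semi_sigma_additive _ _ _ (pushforward (lebesgue_measure \x mu)%E phi')).
Qed.

(** The same function on the measurable type, where it carries the measure structure. *)
Definition volume n : set (mcV n) -> \bar R := @lebesgue_volume R n.

HB.instance Definition _ n := isMeasure.Build _ (mcV n) R (@volume n)
  (lebesgue_volume0 n) (@lebesgue_volume_ge0 n) (@lebesgue_volume_sigma_additive n).

HB.instance Definition _ n := @Measure_isSigmaFinite.Build _ (mcV n) R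
  (@volume n) (lebesgue_volume_sigma_finite n).

End VolumeMeasure.
Notation mcV R n := (g_sigma_algebraType (@cylinder R n)).

(** * Invariance of volume *)

Section VolumeInvariance.
Variable R : realType.

Local Notation leb := (@lebesgue_measure R).
Local Notation vol := (@lebesgue_volume R _).

Lemma lebesgue_volumeS n (A : set 'cV[R]_(1 + n)) :
  @lebesgue_volume R (1 + n) A =
  (\int[leb]_t @lebesgue_volume R n [set y | A (col_mx (t : R)%:M y)])%E.
Proof. by []. Qed.

(** The push-forward along the translation agrees with Lebesgue measure on half-open intervals,
    which determine it. *)
Lemma lebesgue_measure_translate (A : set (measurableTypeR R)) (c : R) :
  measurable A -> leb [set t | A (t + c)] = leb A.
Proof.
move=> mA.
have mphi : measurable_fun setT
    ((fun t => t + c) : measurableTypeR R -> measurableTypeR R).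
  by apply: measurable_funD => //; exact: measurable_cst.
pose phi' : {mfun measurableTypeR R >-> measurableTypeR R} :=
  HB.pack ((fun t => t + c) : measurableTypeR R -> measurableTypeR R)
    (isMeasurableFun.Build _ _ _ _ _ mphi).
apply/esym/(@lebesgue_measure_unique R (pushforward leb phi')) => //.
move=> _ [[a b] _ <-]; rewrite /pushforward/=.
transitivity (leb `](a - c), (b - c)]%classic); last first.
  by congr lebesgue_measure; apply/seteqP; split => t /=;
    rewrite !in_itv/= ltrBlDr lerBrDr.
by rewrite !lebesgue_measure_itv/= !lte_fin ltrD2r -!EFinD opprB addrA subrK.
Qed.

Lemma integral_translate (f : measurableTypeR R -> \bar R) (c : R) :
  measurable_fun setT f -> (forall t, 0 <= f t)%E ->
  (\int[leb]_t f ((t : R) + c)%R = \int[leb]_t f t)%E.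
Proof.
move=> mf f0.
have mphi : measurable_fun setT
    ((fun t => t + c) : measurableTypeR R -> measurableTypeR R).
  by apply: measurable_funD => //; exact: measurable_cst.
have := @ge0_integral_pushforward _ _ _ _ R _ mphi leb setT f measurableT mf (fun x _ => f0 x).
rewrite preimage_setT => <-; apply: eq_measure_integral => A mA _.
exact: lebesgue_measure_translate.
Qed.

Lemma measurable_affine n (M : 'M[R]_n) (v : 'cV[R]_n) (A : set (mcV R n)) :
  measurable A -> measurable ([set x : 'cV[R]_n | A (M *m x + v)] : set (mcV R n)).
Proof.
move=> mA.
have : measurable_fun setT (fun x : mcV R n => M *m x + v : mcV R n).
  apply: measurable_fun_mcV => i.
  rewrite (_ : (fun _ => _) = (fun x : mcV R n =>
    \sum_j M i j * (x : 'cV[R]_n) j 0 + v i 0)); last first.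
    by apply/funext => x; rewrite !mxE.
  apply: measurable_funD => //; apply: measurable_sum => j.
  by apply: measurable_funM => //; exact: measurable_coord.
by move=> /(_ measurableT A mA); rewrite setTI.
Qed.

Lemma measurable_col_mx_preimage n (A : set (mcV R (1 + n))) :
  measurable A -> measurable [set p : measurableTypeR R * mcV R n |
    A (col_mx p.1%:M p.2)].
Proof. by move=> mA; have := @measurable_col_mx R n measurableT A mA; rewrite setTI. Qed.

Lemma measurable_section n (A : set (mcV R (1 + n))) (t : R) :
  measurable A ->
  measurable ([set y : 'cV[R]_n | A (col_mx t%:M y)] : set (mcV R n)).
Proof.
move=> /measurable_col_mx_preimage/(measurable_xsection t).
by rewrite (_ : xsection _ _ = [set y | A (col_mx t%:M y)])//; apply/seteqP; split => y;
  rewrite /xsection/= inE.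
Qed.

Lemma measurable_fiber n (A : set (mcV R (1 + n))) (y : 'cV[R]_n) :
  measurable A ->
  measurable ([set t : measurableTypeR R | A (col_mx t%:M y)]).
Proof.
move=> /measurable_col_mx_preimage/(measurable_ysection (y : mcV R n)).
by rewrite (_ : ysection _ _ = [set t | A (col_mx t%:M y)])//; apply/seteqP; split => t;
  rewrite /ysection/= inE.
Qed.

Lemma measurable_fun_volume_section n (A : set (mcV R (1 + n))) :
  measurable A ->
  measurable_fun setT (fun t : measurableTypeR R => vol [set y | A (col_mx t%:M y)]).
Proof.
move=> /measurable_col_mx_preimage mA.
apply: eq_measurable_fun (measurable_fun_xsection
  (@volume R n : {sigma_finite_measure set (mcV R n) -> \bar R}) mA) => t _ /=.
congr lebesgue_volume; apply/seteqP; split => y;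
  by rewrite /xsection/= inE.
Qed.

Lemma measurable_fun_fiber n (A : set (mcV R (1 + n))) :
  measurable A ->
  measurable_fun setT (fun y : mcV R n => leb [set t | A (col_mx t%:M y)]).
Proof.
move=> /measurable_col_mx_preimage mA.
apply: eq_measurable_fun (measurable_fun_ysection leb mA) => y _ /=.
congr lebesgue_measure; apply/seteqP; split => t;
  by rewrite /ysection/= inE.
Qed.

(** The definition slices at a fixed first coordinate. Slicing into lines parallel to the first axis
    is what motions along that axis require. *)
Lemma lebesgue_volume_fubini n (A : set (mcV R (1 + n))) : measurable A ->
  lebesgue_volume (A : set 'cV[R]_n.+1) =
  (\int[@volume R n]_y leb [set t | A (col_mx t%:M y)])%E.
Proof.
move=> /measurable_col_mx_preimage mA.
have := indic_fubini_tonelli leb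
  (@volume R n : {sigma_finite_measure set (mcV R n) -> \bar R}) mA.
rewrite indic_fubini_tonelli_FE ?indic_fubini_tonelli_GE//.
set F := (X in (X = _)%E); set G := (X in (_ = X)%E).
move=> FG; transitivity F; last (rewrite FG; apply: eq_integral => y _ /=).
  apply: eq_integral => t _ /=; congr lebesgue_volume.
  by apply/seteqP; split => y; rewrite /xsection/= inE.
congr lebesgue_measure.
by apply/seteqP; split => t; rewrite /ysection/= inE.
Qed.

Lemma lebesgue_volume_translate n (A : set (mcV R n)) (v : 'cV[R]_n) :
  measurable A -> vol [set x : 'cV[R]_n | A (x + v)] = vol A.
Proof.
elim: n A v => [|n IH] A v mA.
  by congr lebesgue_volume; apply/seteqP; split => x /=; rewrite [v]flatmx0 addr0.
rewrite -[v](@vsubmxK _ 1 n) [usubmx _]mx11_scalar.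
set c := _ 0 0; set w := dsubmx _ => /=.
rewrite -[RHS](@integral_translate _ c)//.
- apply: eq_integral => t _; 
  rewrite -(IH [set y | A (col_mx ((t : R) + c)%:M y : 'cV_(1 + n))] w).
    by congr lebesgue_volume; apply/funext => y /=; congr (A _);
      rewrite raddfD/=; exact: (@add_col_mx _ 1 n 1).
  exact: measurable_section.
- exact: measurable_fun_volume_section.
- by move=> t; exact: lebesgue_volume_ge0.
Qed.

(** Preimages are measurable for every [M], and they compose without inverses. *)
Definition volume_preserving n (M : 'M[R]_n) := forall A : set (mcV R n),
  measurable A -> vol [set x : 'cV[R]_n | A (M *m x)] = vol (A : set 'cV[R]_n).

Lemma volume_preserving_mul n (M N : 'M[R]_n) :
  volume_preserving M -> volume_preserving N -> volume_preserving (M *m N).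
Proof.
move=> pM pN A mA; rewrite -[RHS]pM// -[RHS]pN; last first.
  have := measurable_affine M 0 mA.
  by congr measurable; apply/funext => x /=; rewrite addr0.
by congr lebesgue_volume; apply/funext => x /=; rewrite mulmxA.
Qed.

Definition lower_shear n (c : 'cV[R]_n) : 'M[R]_(1 + n) := block_mx 1%:M 0 c 1%:M.
Definition upper_shear n (r : 'rV[R]_n) : 'M[R]_(1 + n) := block_mx 1%:M r 0 1%:M.

(** On the slice with first coordinate [t] the shear is the translation by [t *: c]. *)
Lemma volume_preserving_lower n (c : 'cV[R]_n) : volume_preserving (lower_shear c).
Proof.
move=> A mA; rewrite !lebesgue_volumeS; apply: eq_integral => t _.
rewrite -[RHS](lebesgue_volume_translate (t *: c)); last exact: measurable_section.
congr lebesgue_volume; apply/funext => y /=.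
rewrite mul_block_col !mul1mx mul0mx addr0 mul_mx_scalar; congr (A (col_mx _ _)).
exact: addrC.
Qed.

(** The shear translates the line over [y] by [r *m y]. *)
Lemma volume_preserving_upper n (r : 'rV[R]_n) : volume_preserving (upper_shear r).
Proof.
move=> A mA; rewrite (lebesgue_volume_fubini mA) lebesgue_volume_fubini; last first.
  have := measurable_affine (upper_shear r) 0 mA.
  by congr measurable; apply/funext => x /=; rewrite addr0.
apply: eq_integral => y _.
rewrite -[RHS](lebesgue_measure_translate ((r *m y) 0 0)); last exact: measurable_fiber.
congr lebesgue_measure; apply/funext => t /=.
rewrite mul_block_col !mul1mx mul0mx add0r [X in _ + X]mx11_scalar.
by congr (A (col_mx _ _)); rewrite -[LHS]raddfD.
Qed.

Lemma volume_preserving_diag n (B : 'M[R]_n) : volume_preserving B ->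
  volume_preserving (block_mx 1%:M 0 0 B : 'M[R]_(1 + n)).
Proof.
move=> pB A mA; rewrite !lebesgue_volumeS; apply: eq_integral => t _.
rewrite -[RHS]pB; last exact: measurable_section.
by congr lebesgue_volume; apply/funext => y /=;
  rewrite mul_block_col !mul1mx !mul0mx addr0 add0r.
Qed.

Lemma upper_shear_block n r' (a : 'M[R]_1) r c (B : 'M[R]_n) :
  upper_shear r' *m block_mx a r c B =
  block_mx (a + r' *m c) (r + r' *m B) c B.
Proof. by rewrite mulmx_block !mul1mx !mul0mx !add0r. Qed.

Lemma upper_shearK n (r : 'rV[R]_n) : upper_shear (- r) *m upper_shear r = 1%:M.
Proof. by rewrite upper_shear_block mulmx0 addr0 mulmx1 addrN -scalar_mx_block. Qed.

Lemma lower_shearK n (c : 'cV[R]_n) : lower_shear (- c) *m lower_shear c = 1%:M.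
Proof.
by rewrite mulmx_block !mul1mx !mulmx1 mulmx0 !mul0mx !addr0 add0r addNr -scalar_mx_block.
Qed.

Lemma volume_preserving_upperV n (r : 'rV[R]_n) M :
  volume_preserving (upper_shear r *m M) -> volume_preserving M.
Proof.
move=> pM; rewrite -[M]mul1mx -(upper_shearK r) -mulmxA.
by apply: volume_preserving_mul => //; exact: volume_preserving_upper.
Qed.

Lemma volume_preserving_lowerV n (c : 'cV[R]_n) M :
  volume_preserving (lower_shear c *m M) -> volume_preserving M.
Proof.
move=> pM; rewrite -[M]mul1mx -(lower_shearK c) -mulmxA.
by apply: volume_preserving_mul => //; exact: volume_preserving_lower.
Qed.

Lemma det_upper_shear n (r : 'rV[R]_n) : \det (upper_shear r) = 1.
Proof. by rewrite det_ublock !det1 mulr1. Qed.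

Lemma det_lower_shear n (c : 'cV[R]_n) : \det (lower_shear c) = 1.
Proof. by rewrite det_lblock !det1 mulr1. Qed.

(* Row operations reduce the top left entry to 1, then clear the first row and column. *)
Lemma volume_preserving_det1 n (M : 'M[R]_n) : \det M = 1 -> volume_preserving M.
Proof.
elim: n M => [|n IH].
  by move=> M _ A mA; congr lebesgue_volume; apply/funext => x /=; rewrite [M *m x]flatmx0 [x]flatmx0.
have step1 r c (B : 'M[R]_n) :
    \det (block_mx 1%:M r c B : 'M[R]_(1 + n)) = 1 ->
    volume_preserving (block_mx 1%:M r c B : 'M[R]_(1 + n)).
  move=> d1; apply: (@volume_preserving_lowerV _ (- c)).
  have E : lower_shear (- c) *m block_mx 1%:M r c B =
      block_mx 1%:M 0 0 (B - c *m r) *m upper_shear r.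
    rewrite !mulmx_block !mul1mx !mul0mx !mulmx1 !mulmx0 ?add0r ?addr0.
    by rewrite mulNmx addNr [- _ + B]addrC.
  rewrite E; apply: volume_preserving_mul; last exact: volume_preserving_upper.
  apply: volume_preserving_diag; apply: IH.
  have := congr1 determinant E; rewrite !det_mulmx det_upper_shear det_lower_shear.
  by rewrite d1 det_ublock det1 !mul1r mulr1.
have step2 (a : 'M[R]_1) r c (B : 'M[R]_n) : c != 0 ->
    \det (block_mx a r c B : 'M[R]_(1 + n)) = 1 ->
    volume_preserving (block_mx a r c B : 'M[R]_(1 + n)).
  move=> /cV0Pn[i ci] d1.
  (* The multiple of a lower row that turns the top left entry into 1. *)
  pose s : 'rV[R]_n := ((1 - a 0 0) / c i 0) *: delta_mx 0 i.
  apply: (@volume_preserving_upperV _ s); rewrite upper_shear_block.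
  have E : a + s *m c = 1%:M.
    apply/matrixP => j k; rewrite !ord1 -scalemxAl -rowE !mxE.
    by rewrite divfK// addrC subrK.
  rewrite E; apply: step1.
  by rewrite -E -upper_shear_block det_mulmx det_upper_shear mul1r.
move=> M; rewrite -(@submxK _ 1 n 1 n M).
move: (@ulsubmx _ 1 n 1 n M) (@ursubmx _ 1 n 1 n M) (@dlsubmx _ 1 n 1 n M) (@drsubmx _ 1 n 1 n M) => a r c B {M}.
have [c0|c0] := eqVneq c 0; last exact: step2.
rewrite c0 => d1.
have [a1|a1] := eqVneq a 1%:M; first by rewrite a1 in d1 |- *; exact: step1.
have dab : \det a * \det B = 1 := etrans (esym (det_ublock a r B)) d1.
have aN0 : a != 0.
  by apply: contra_eqN dab => /eqP ->; rewrite det0 mul0r eq_sym oner_eq0.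
(* In size 1 the determinant is the only entry, which forces [a] to be 1. From size 2 on, adding the
   first row to all others makes the first column nonzero, because [a] is. *)
case: n IH step1 step2 r c B c0 d1 dab => [|n] IH step1 step2 r c B c0 d1 dab.
  exfalso; move/eqP: a1; apply; rewrite [a]mx11_scalar; congr (_%:M).
  by move: dab; rewrite [B]flatmx0 det_mx00 mulr1 {1}[a]mx11_scalar det_scalar expr1.
pose d : 'cV[R]_(n.+1) := const_mx 1.
apply: (@volume_preserving_lowerV _ d).
have E : lower_shear d *m block_mx a r 0 B = block_mx a r (d *m a) (d *m r + B).
  by rewrite mulmx_block !mul1mx !mul0mx !addr0.
rewrite E; apply: step2.
  apply: contraNneq aN0 => da; apply/eqP/matrixP => i j; rewrite !ord1.
  by have /matrixP/(_ ord0 0) := da; rewrite !mxE big_ord1 mxE mul1r.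
by rewrite -E det_mulmx det_lower_shear mul1r.
Qed.

End VolumeInvariance.

(** * Continuity of volume *)

Section VolumeContinuity.
Variable R : realType.

Local Notation leb := (@lebesgue_measure R).
Local Notation vol := (@lebesgue_volume R _).

(** A bounded interval lies between the open and the closed interval with ends [inf A] and [sup A],
    and these have the same measure. The thickened set moves each end by at most [e]. *)
Lemma lebesgue_measure_thicken (A : set (measurableTypeR R)) (M e : R) : 0 <= e ->
  (forall x y z, A x -> A y -> x <= z <= y -> A z) ->
  A !=set0 -> (forall x, A x -> - M <= x <= M) ->
  measurable A -> measurable [set t | exists s : R, (`|s| <= e)%R /\ A ((t : R) - s)%R] ->
  (leb [set t | exists s : R, (`|s| <= e)%R /\ A ((t : R) - s)%R] <= leb A + (2 * e)%:E)%E.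
Proof.
move=> e0 iA A0 AM mA mAe.
have hi : has_inf A by split => //; exists (- M) => x /AM/andP[].
have hs : has_sup A by split => //; exists M => x /AM/andP[].
have infsup : inf A <= sup A.
  have [x Ax] := A0; apply: (@le_trans _ _ x).
    by apply: ge_inf => //; case: hi.
  by apply: ub_le_sup => //; case: hs.
apply: (@le_trans _ _ (leb `[(inf A - e), (sup A + e)]%classic)).
  apply: le_measure; [rewrite inE|rewrite inE; exact: measurable_itv|]; first by [].
  move=> t /= [s [+ At]]; rewrite ler_norml in_itv/= => /andP[s1 s2].
  have : inf A <= t - s := ge_inf hi.2 At.
  have : t - s <= sup A := ub_le_sup hs.2 At.
  by move=> ? ?; apply/andP; split; lra.
apply: (@le_trans _ _ (leb `](inf A), (sup A)[%classic + (2 * e)%:E)%E); last first.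
  rewrite leeD2r//; apply: le_measure; [rewrite inE; exact: measurable_itv|by rewrite inE|].
  move=> t /=; rewrite in_itv/= => /andP[it ts].
  have [x Ax xt] := inf_lt hi.1 it.
  have [y Ay ty] := sup_gt hs.1 ts.
  by apply: (iA x y) => //; rewrite (ltW xt) (ltW ty).
rewrite !lebesgue_measure_itv/= !lte_fin.
case: ifPn => _; case: ifPn => [_|]; rewrite ?lee_fin -?EFinD ?lee_fin -?EFinD ?lee_fin.
all: rewrite -?leNgt ?addr0 ?add0r => *; try lra.
Qed.

(** Integrates a slicewise bound whose error [c] occurs only over the bounded shadow [D] of a
    body. *)
Lemma ge0_integral_le_indic d (T : measurableType d)
  (mu : {measure set T -> \bar R}) (f g : T -> \bar R) (D : set T) (c : R) :
  measurable_fun setT f -> measurable_fun setT g ->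
  (forall x, 0 <= f x)%E -> (forall x, 0 <= g x)%E -> measurable D -> 0 <= c ->
  (forall x, f x <= g x + (c * \1_D x)%:E)%E ->
  (\int[mu]_x f x <= \int[mu]_x g x + c%:E * mu D)%E.
Proof.
move=> mf mg f0 g0 mD c0 fg.
have m1 : measurable_fun setT (fun x => (c * \1_D x)%:E).
  apply/measurable_EFinP; apply: measurable_funM => //; exact: measurable_indic.
have c1 x : (0 <= (c * \1_D x)%:E)%E by rewrite lee_fin mulr_ge0// indicE.
have -> : (c%:E * mu D = \int[mu]_x (c * \1_D x)%:E)%E.
  under eq_integral do rewrite EFinM.
  rewrite ge0_integralZl_EFin//; first by rewrite integral_indic// setIT.
  by apply/measurable_EFinP; exact: measurable_indic.
rewrite -ge0_integralD//; apply: ge0_le_integral => //.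
by apply: emeasurable_funD.
Qed.

(** The Minkowski sum of [K] with a segment of length [2 * e] centred at the origin, along axis
    [i]. *)
Definition thicken n (i : 'I_n) (e : R) (K : set 'cV[R]_n) : set 'cV[R]_n :=
  [set x | exists s, `|s| <= e /\ K (x - s *: delta_mx i 0)].

Lemma convex_section n (K : set 'cV[R]_(1 + n)) (t : R) : @convex_set R _ K ->
  @convex_set R _ [set y : 'cV[R]_n | K (col_mx t%:M y)].
Proof.
move=> /convex_setP cK; apply/convex_setP => x y l /= Kx Ky l01.
have := cK _ _ _ Kx Ky l01.
by rewrite !scale_col_mx add_col_mx -scalerDl addrC subrK scale1r.
Qed.

(* Lines in direction [i] meet [K] in intervals, which get longer by at most [2 * e]. *)
Lemma lebesgue_volume_thicken n (i : 'I_n) (K : set (mcV R n)) (M e : R) :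
  0 <= M -> 0 <= e -> @convex_set R _ (K : set 'cV[R]_n) -> K `<=` box (- M) M ->
  measurable K -> measurable (thicken i e K : set (mcV R n)) ->
  (vol (thicken i e K) <= vol (K : set 'cV[R]_n) + (2 * e * (2 * M) ^+ n.-1)%:E)%E.
Proof.
move=> M0 e0; have MM : - M <= M by lra.
have interp (u v w : R) : v - u != 0 ->
  (w - u) / (v - u) * v + (1 - (w - u) / (v - u)) * u = w by move=> ?; field.
elim: n i K => [[]//|n IH] i K cK KM mK mKe.
have delta0 (q : 'I_1) : delta_mx (lshift n q) 0 = col_mx 1%:M 0 :> 'cV[R]_(1 + n).
  apply/matrixP => j k; rewrite !ord1 mxE.
  case: (split_ordP j) => l ->; rewrite ?col_mxEu ?col_mxEd !mxE/= ?ord1 ?eqxx//.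
have deltaS j : delta_mx (rshift 1 j) 0 = col_mx 0 (delta_mx j 0) :> 'cV[R]_(1 + n).
  apply/matrixP => l k; rewrite !ord1 mxE.
  case: (split_ordP l) => m ->; rewrite ?col_mxEu ?col_mxEd !mxE/= ?ord1 ?eq_lrshift ?eq_rshift//.
case: (split_ordP (i : 'I_(1 + n))) mKe => q -> {i} mKe; pose K1 : set 'cV[R]_(1 + n) := K;
  have KM1 : K1 `<=` @box R (1 + n) (- M) M by []; have cK1 : @convex_set R _ K1 by [].
(* Along the first axis every fibre gains at most [2 * e], and the nonempty fibres lie over a box in
   the other coordinates. *)
- rewrite (lebesgue_volume_fubini mK) (lebesgue_volume_fubini mKe).
  have fib y : [set t : measurableTypeR R | thicken (lshift n q) e K1 (col_mx t%:M y)] =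
      [set t : measurableTypeR R | exists s : R, `|s| <= e /\ K1 (col_mx ((t : R) - s)%:M y)].
    apply/funext => t /=; rewrite /thicken/= delta0; apply/propext.
    by split=> -[s [se Ks]]; exists s; split => //; move: Ks;
      rewrite scale_col_mx scaler0 scale_scalar_mx mulr1 opp_col_mx add_col_mx oppr0 addr0 raddfB.
  have -> : (2 * e * (2 * M) ^+ n)%:E = ((2 * e)%:E * @volume R n (box (- M) M))%E.
    rewrite /volume lebesgue_volume_box// EFinM; congr (_ * (_ ^+ n)%:E)%E; lra.
  apply: ge0_integral_le_indic.
  + exact: measurable_fun_fiber.
  + exact: measurable_fun_fiber.
  + by move=> y; exact: measure_ge0.
  + by move=> y; exact: measure_ge0.
  + exact: measurable_box.
  + by rewrite mulr_ge0.
  move=> y; have [[t0 Kt0]|noK] := pselect (exists t : R, K1 (col_mx t%:M y)); last first.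
    rewrite (_ : [set t | thicken _ _ _ _] = set0) ?measure0.
      by rewrite adde_ge0// lee_fin !mulr_ge0// indicE.
    rewrite fib; apply/seteqP; split => // t /= [s [_ Ks]].
    by apply: noK; exists (t - s).
  have ct t z : (col_mx t%:M z : 'cV[R]_(1 + n)) (lshift n q) 0 = t.
    by rewrite col_mxEu [q]ord1 mxE eqxx mulr1n.
  rewrite indicE mem_set ?mulr1; last first.
    by move=> i; have := KM1 _ Kt0 (rshift 1 i); rewrite col_mxEd.
  rewrite fib; apply: (@lebesgue_measure_thicken [set t | K1 (col_mx t%:M y)] M e) => //.
  + move=> u v w Ku Kv uwv.
    have [uv|uv] := eqVneq u v.
      by have -> : w = u by apply/eqP; rewrite eq_le {1}uv andbC.
    have uv0 : 0 < v - u by rewrite subr_gt0 lt_neqAle uv; case/andP: uwv => /le_trans; apply.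
    have /convex_setP /(_ _ _ ((w - u) / (v - u)) Kv Ku) := cK1.
    rewrite !scale_col_mx add_col_mx -scalerDl [_ / _ + (1 - _)]addrC subrK scale1r.
    rewrite !scale_scalar_mx -raddfD/=.
    rewrite (interp u v w) ?gt_eqF//.
    by apply; rewrite divr_ge0 ?ler_pdivrMr ?(ltW uv0)//; case/andP: uwv => *; lra.
  + by exists t0.
  + by move=> t Kt; have := KM1 _ Kt (lshift n q); rewrite ct.
  + exact: measurable_fiber.
  + by rewrite -fib; exact: measurable_fiber.
(* Along another axis each slice is itself thickened, and the error from the induction hypothesis is
   integrated over [[- M, M]]. *)
- rewrite !lebesgue_volumeS.
  have sec (t : R) : [set y | thicken (rshift 1 q) e K1 (col_mx t%:M y)] =
      thicken q e [set y | K1 (col_mx t%:M y)].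
    apply/funext => y; rewrite /thicken/= deltaS; apply/propext.
    by split=> -[s [se Ks]]; exists s; split => //; move: Ks;
      rewrite scale_col_mx scaler0 opp_col_mx add_col_mx oppr0 addr0.
  have -> : (2 * e * (2 * M) ^+ n)%:E =
      ((2 * e * (2 * M) ^+ n.-1)%:E * leb `[(- M)%R, M]%classic)%E.
    rewrite lebesgue_measure_itv/= lte_fin.
    (* The index [q] shows that [n] is positive, so [n.-1] is a genuine predecessor. *)
    have n1 : (0 < n)%N by exact: leq_ltn_trans (leq0n q) (ltn_ord q).
    rewrite -{1}(prednK n1) exprSr mulrA.
    case: ifPn => [_|]; first by rewrite -EFinD -EFinM; congr (_ * _)%:E; ring.
    by rewrite -leNgt => ?; rewrite (_ : M = 0) ?mulr0 ?mule0//; lra.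
  apply: ge0_integral_le_indic.
  + exact: measurable_fun_volume_section.
  + exact: measurable_fun_volume_section.
  + by move=> t; exact: lebesgue_volume_ge0.
  + by move=> t; exact: lebesgue_volume_ge0.
  + exact: measurable_itv.
  + by rewrite !mulr_ge0// exprn_ge0// mulr_ge0.
  rewrite -/K1 => t; rewrite sec.
  have [tM|tM] := boolP (t \in `[(- M), M]).
    rewrite indicE mem_set// mulr1; apply: IH.
    + exact: convex_section.
    + by move=> y Ky i; have := KM1 _ Ky (rshift 1 i); rewrite col_mxEd.
    + exact: measurable_section.
    + by rewrite -sec; exact: measurable_section.
  rewrite (_ : thicken _ _ _ = set0) ?lebesgue_volume0.
    by rewrite adde_ge0 ?lebesgue_volume_ge0// lee_fin !mulr_ge0// ?exprn_ge0 ?mulr_ge0// indicE.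
  apply/seteqP; split => // y /= [s [_ Ks]]; move/negP: tM; apply.
  have := KM1 _ Ks (lshift n ord0).
  by rewrite col_mxEu mxE eqxx mulr1n in_itv.
Qed.

Lemma convex_thicken n (i : 'I_n) (e : R) (K : set 'cV[R]_n) :
  @convex_set R _ K -> @convex_set R _ (thicken i e K).
Proof.
move=> /convex_setP cK; apply/convex_setP => x y l [s [se Ks]] [t [te Kt]] l01.
exists (l * s + (1 - l) * t); split.
  have /andP[l0 l1] := l01.
  rewrite (le_trans (ler_normD _ _))// !normrM (ger0_norm l0) [`|1 - l|]ger0_norm ?subr_ge0//.
  nra.
have := cK _ _ _ Ks Kt l01; congr (K _).
by rewrite !scalerBr !scalerA [(l * s + _) *: _]scalerDl opprD addrACA.
Qed.

Lemma compact_thicken n (i : 'I_n) (e : R) (K : set 'cV[R]_n) :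
  compact K -> compact (thicken i e K).
Proof.
move=> cK; rewrite (_ : thicken _ _ _ =
    (fun p : 'cV[R]_n * R => p.1 + p.2 *: delta_mx i 0) @` (K `*` `[(- e), e])).
  apply: continuous_compact; last first.
    by apply: compact_setX => //; exact: segment_compact.
  apply: continuous_subspaceT => -[x s].
  by apply: cvgD; [exact: cvg_fst|apply: cvgZ; [exact: cvg_snd|exact: cvg_cst]].
apply/seteqP; split => [x [s [se Ks]]|_ [[x s] [/= Kx +] <-]].
  exists (x - s *: delta_mx i 0, s); last by rewrite /= subrK.
  by split => //=; rewrite in_itv/= -ler_norml.
by rewrite in_itv/= -ler_norml => se; exists s; rewrite addrK.
Qed.

Lemma thicken_box n (i : 'I_n) (M N e : R) (K : set 'cV[R]_n) : 0 <= e ->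
  M + e <= N -> K `<=` box (- M) M -> thicken i e K `<=` box (- N) N.
Proof.
move=> e0 MN KM x [s [se /KM xM]] j; have := xM j; rewrite !mxE eqxx andbT.
have := se; rewrite ler_norml => /andP[? ?].
by case: (j == i); rewrite ?mulr1 ?mulr0 => /andP[? ?]; apply/andP; split; lra.
Qed.

(** Every step enlarges the box by [e]; the final half-width [N] bounds the error of all of them
    uniformly. *)
Lemma lebesgue_volume_thickens n (s : seq 'I_n) (K : set 'cV[R]_n) (M N e : R) :
  0 <= M -> 0 <= e -> M + e * (size s)%:R <= N ->
  @convex_set R _ K -> K `<=` box (- M) M -> compact K ->
  (vol (foldl (fun K i => thicken i e K) K s) <=
   vol K + ((size s)%:R * (2 * e * (2 * N) ^+ n.-1))%:E)%E.
Proof.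
move=> + e0; elim: s K M => [|i s IH] K M M0 /= MN cK KM cpK.
  by rewrite mul0r adde0.
rewrite -[(size s).+1]addn1 natrD in MN *.
have es0 : 0 <= e * (size s)%:R by rewrite mulr_ge0.
apply: (le_trans (IH _ (M + e) _ _ _ _ _)).
- by rewrite addr_ge0.
- by apply: le_trans MN; rewrite mulrDr mulr1; lra.
- exact: convex_thicken.
- exact: thicken_box KM.
- exact: compact_thicken.
rewrite [((size s)%:R + 1) * _]mulrDl mul1r EFinD addeA [leRHS]addeAC leeD2r//.
apply: (le_trans (@lebesgue_volume_thicken _ i K M e _ _ _ _ _ _)) => //.
- exact: compact_measurable_mcV.
- by apply: compact_measurable_mcV; exact: compact_thicken.
rewrite leeD2l// lee_fin ler_wpM2l ?mulr_ge0// lerXn2r ?nnegrE ?mulr_ge0//; nra.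
Qed.

Lemma thickensP n (s : seq 'I_n) (K : set 'cV[R]_n) (e : R) (y : 'cV[R]_n) (c : 'I_n -> R) :
  K y -> (forall i, `|c i| <= e) ->
  foldl (fun K i => thicken i e K) K s (y + \sum_(i <- s) c i *: delta_mx i 0).
Proof.
move=> Ky ce; elim: s y K Ky => [|i s IH] y K Ky /=; first by rewrite big_nil addr0.
rewrite big_cons addrA; apply: IH.
by exists (c i); rewrite addrK.
Qed.

Lemma polytope_box n (P : polytope R n) : exists2 M, 0 <= M & (P : set _) `<=` box (- M) M.
Proof.
have [M PM] := polytope_enorm_bounded P; exists M.
  by have [x /PM xM] := polytope_neq0 P; exact: le_trans (enorm_ge0 x) xM.
by move=> x /PM xM i; rewrite -ler_norml (le_trans (le_coord_enorm _ _)).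
Qed.

Lemma polytope_convex n (P : polytope R n) : @convex_set R _ (P : set 'cV[R]_n).
Proof. by have [F [_ _ ->]] := polytopeP P; exact: conv_hull_convex. Qed.

Lemma polytope_measurable n (P : polytope R n) : measurable (P : set (mcV R n)).
Proof. by apply: compact_measurable_mcV; exact: compact_polytope. Qed.

Lemma polytope_volume_fin n (P : polytope R n) : vol (P : set 'cV[R]_n) \is a fin_num.
Proof.
have [M M0 PM] := polytope_box P.
rewrite ge0_fin_numE ?lebesgue_volume_ge0//.
apply: le_lt_trans (_ : (vol (box (- M) M : set 'cV[R]_n) < +oo)%E).
  apply: (@le_measure _ _ _ (@volume R n)); rewrite ?inE//.
    exact: polytope_measurable.
  exact: measurable_box.
by rewrite lebesgue_volume_box ?ltry//; lra.
Qed.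

Lemma V_nK n (P : polytope R n) : (V_n P)%:E = vol (P : set 'cV[R]_n).
Proof. by rewrite /V_n fineK// polytope_volume_fin. Qed.

(** A point of [P] differs from one of [Q] by a vector with all coordinates at most [e] in absolute
    value. So [P] lies in [Q] thickened once along each of the [n] axes, which ends in the box of
    half-width [M + e * n%:R]. *)
Lemma V_n_hausdorff n (P Q : polytope R n) (M e : R) : 0 <= M -> 0 <= e ->
  hausdorff_dist P Q < e -> (Q : set _) `<=` box (- M) M ->
  V_n P <= V_n Q + n%:R * (2 * e * (2 * (M + e * n%:R)) ^+ n.-1).
Proof.
move=> M0 e0 PQe QM; rewrite -lee_fin EFinD !V_nK.
have := @lebesgue_volume_thickens n (enum 'I_n) Q M _ e M0 e0 (lexx _).
rewrite size_enum_ord; move=> /(_ (@polytope_convex _ Q) QM (@compact_polytope _ _ Q)).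
apply: le_trans; apply: (@le_measure _ _ _ (@volume R n)); rewrite ?inE//.
- exact: polytope_measurable.
- apply: compact_measurable_mcV.
  elim: (enum 'I_n) (Q : set _) (@compact_polytope _ _ Q) => //= i s IH K cK.
  by apply: IH; exact: compact_thicken.
move=> x Px; have [|y Qy xy] := @dist_to_lt _ _ Q x e.
  by apply: le_lt_trans PQe; have [+ _] := (hausdorff_distP P Q _).1 (lexx _); apply.
rewrite (_ : x = y + \sum_(i <- enum 'I_n) (x - y) i 0 *: delta_mx i 0).
  apply: thickensP => // i; apply: le_trans (ltW xy); exact: le_coord_enorm.
rewrite big_enum/= -[LHS](subrK y) addrC; congr (y + _).
rewrite [LHS]matrix_sum_delta; apply: eq_bigr => i _.
by rewrite big_ord1.
Qed.

Lemma V_n_continuous n : continuous (fun P : polytope R n => V_n P).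
Proof.
move=> P; have [M M0 PM] := polytope_box P.
(* A Lipschitz constant for distances up to 1 from [P]: as [d <= 1], both bodies lie in the box of
   half-width [M + 1]. The last [+ 1] keeps [C] positive. *)
pose C := n%:R * (2 * (2 * (M + 1 + n%:R)) ^+ n.-1) + 1.
have C0 : 0 < C by rewrite ltr_wpDl// !mulr_ge0// exprn_ge0// mulr_ge0// !addr_ge0.
have FP : Filter (nbhs P) := nbhs_filter P.
apply/(@cvgrPdist_le _ _ _ (nbhs P) FP) => /= eps eps0.
pose d := Num.min 1 (eps / C).
have d0 : 0 < d by rewrite lt_min ltr01 divr_gt0.
have d1 : d <= 1 by rewrite ge_min lexx.
apply/nbhs_ballP; exists d => //= Q; rewrite ballEmdist/= => PQ.
have QM : (Q : set _) `<=` box (- (M + 1)) (M + 1).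
  move=> x Qx; have [|y Py xy] := @dist_to_lt _ _ P x d.
    apply: le_lt_trans PQ; have [_ +] := (hausdorff_distP P Q _).1 (lexx _); exact.
  move=> i; have := le_trans (le_coord_enorm (x - y) i) (ltW xy).
  have := PM _ Py i; rewrite !mxE ler_norml => /andP[? ?] /andP[? ?].
  by apply/andP; split; lra.
have PM1 : (P : set _) `<=` box (- (M + 1)) (M + 1).
  by move=> x /PM xM i; have /andP[? ?] := xM i; apply/andP; split; lra.
have M10 : 0 <= M + 1 by lra.
have Cd : n%:R * (2 * d * (2 * (M + 1 + d * n%:R)) ^+ n.-1) <= eps.
  apply: (@le_trans _ _ (C * d)); last first.
    by rewrite mulrC -ler_pdivlMr// ge_min lexx orbT.
  have YZ : (2 * (M + 1 + d * n%:R)) ^+ n.-1 <= (2 * (M + 1 + n%:R)) ^+ n.-1.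
    rewrite lerXn2r ?nnegrE ?mulr_ge0 ?addr_ge0 ?mulr_ge0 ?(ltW d0)//.
    by rewrite ler_wpM2l// lerD2l ler_piMl.
  have nd0 : 0 <= n%:R * (2 * d) by rewrite !mulr_ge0// ltW.
  have := ler_wpM2l nd0 YZ; rewrite /C.
  by set Y := _ ^+ _; set Z := _ ^+ _ => ?; lra.
have QP : hausdorff_dist Q P < d by rewrite hausdorff_dist_sym.
have := V_n_hausdorff M10 (ltW d0) PQ QM.
have := V_n_hausdorff M10 (ltW d0) QP PM1.
by rewrite ler_norml; move: Cd; set X := _%:R * _ => *; apply/andP; split; lra.
Qed.

End VolumeContinuity.

(** * Joins with a point *)

Section Join.
Variables (R : realType) (n : nat).
Implicit Types (P Q U I : polytope R n) (a : 'cV[R]_n).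

Lemma conv_hull_id (A : set 'cV[R]_n) : @convex_set R _ A -> conv_hull A = A.
Proof.
by move=> cA; apply/seteqP; split; [exact: conv_hull_sub|exact: sub_conv_hull].
Qed.

Lemma conv_hullS (A B : set 'cV[R]_n) : A `<=` B -> conv_hull A `<=` conv_hull B.
Proof.
move=> AB; apply: conv_hull_sub; first exact: conv_hull_convex.
by move=> x /AB; exact: sub_conv_hull.
Qed.

Lemma conv_hullUr (A B : set 'cV[R]_n) : conv_hull (A `|` conv_hull B) = conv_hull (A `|` B).
Proof.
apply/seteqP; split.
  apply: conv_hull_sub; first exact: conv_hull_convex.
  by move=> x [Ax|]; [apply: sub_conv_hull; left|apply: conv_hullS => ?; right].
by apply: conv_hullS => x [Ax|Bx]; [left|right; exact: sub_conv_hull].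
Qed.

Lemma polytope_join_subproof a P : exists F : set 'cV[R]_n,
  [/\ finite_set F, F !=set0 & conv_hull (a |` P) = conv_hull F].
Proof.
have [F [finF [x Fx] ->]] := polytopeP P; exists (a |` F); split.
- by rewrite finite_setU; split => //; exact: finite_set1.
- by exists a; left.
- exact: conv_hullUr.
Qed.

Definition polytope_join a P : polytope R n := Polytope (polytope_join_subproof a P).

Lemma polytope_joinP a P x : (polytope_join a P : set _) x <->
  exists t p, [/\ 0 <= t <= 1, polytope_set P p & x = t *: a + (1 - t) *: p].
Proof.
rewrite /= conv_hull_setU1; last exact: polytope_neq0.
rewrite conv_hull_id; last exact: polytope_convex.
split=> [[[t p] [/= + Pp] <-]|[t [p [t01 Pp ->]]]].
  by rewrite in_itv/= => t01; exists t, p.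
by exists (t, p) => //; split => //=; rewrite in_itv.
Qed.

(** The segment is connected and covered by the closed sets [P] and [Q]. If they did not meet on it,
    its part in [P] would be open and closed, hence all of it, including [q]. *)
Lemma segment_meet P Q U p q : (U = P `|` Q :> set _) ->
  polytope_set P p -> polytope_set Q q ->
  exists2 l : R, 0 <= l <= 1 & (P `&` Q) (l *: p + (1 - l) *: q).
Proof.
move=> UPQ Pp Qq; pose f (l : R) : 'cV[R]_n := l *: p + (1 - l) *: q.
have cf : continuous f.
  move=> l; apply: cvgD; apply: cvgZ; try exact: cvg_cst; first exact: cvg_id.
  by apply: cvgB; [exact: cvg_cst|exact: cvg_id].
have cP S : closed (f @^-1` (polytope_set S)).
  apply: closed_comp; first by move=> *; exact: cf.
  by apply: compact_closed; [exact: norm_hausdorff|exact: compact_polytope].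
have fU l : 0 <= l <= 1 -> (P `|` Q) (f l).
  rewrite -UPQ => l01; have /convex_setP := @polytope_convex _ _ U.
  by apply => //; rewrite UPQ; [left|right].
apply: contrapT => no.
have dis l : 0 <= l <= 1 -> polytope_set P (f l) -> polytope_set Q (f l) -> False.
  by move=> l01 Pl Ql; apply: no; exists l.
have := @segment_connected R 0 1 (`[0, 1] `&` f @^-1` (polytope_set P)).
have f0 : f 0 = q by rewrite /f scale0r subr0 scale1r add0r.
have f1 : f 1 = p by rewrite /f subrr scale0r scale1r addr0.
move=> H; have : `[0, 1]%classic (0 : R) by rewrite /= in_itv/= lexx ler01.
rewrite -H.
- move=> [_ /= Pq]; apply: (@dis 0); first by rewrite lexx ler01.
    by [].
  by rewrite f0.
- by exists 1; split; rewrite /= ?in_itv/= ?ler01 ?lexx// f1.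
- exists (~` (f @^-1` (polytope_set Q))); first by rewrite openC; exact: cP.
  apply/seteqP; split => l [/= l01 H']; split => //.
    by move: l01; rewrite in_itv/= => l01 Ql; exact: (dis l).
  by move: l01; rewrite in_itv/= => /fU[].
- by exists (f @^-1` (polytope_set P)).
Qed.

Lemma polytope_joinU a P Q U : U = P `|` Q :> set _ ->
  polytope_join a U = polytope_join a P `|` polytope_join a Q :> set _.
Proof.
move=> UPQ; apply/seteqP; split=> [x /polytope_joinP[t [p [t01 + ->]]]|x].
  by rewrite UPQ => -[]; [left|right]; apply/polytope_joinP; exists t, p.
by case=> /polytope_joinP[t [p [t01 Pp ->]]]; apply/polytope_joinP; exists t, p;
  split => //; rewrite UPQ; [left|right].
Qed.

(** If [x] is in both joins and is not [a], then [p] and [q] lie on the ray from [a] through [x], at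
    [x] or beyond. So does the point of [I] between them: it is [a + k *: (x - a)] with [1 <= k],
    and [x] is on the segment from [a] to it. *)
Lemma polytope_joinI a P Q U I : U = P `|` Q :> set _ -> I = P `&` Q :> set _ ->
  polytope_join a I = polytope_join a P `&` polytope_join a Q :> set _.
Proof.
move=> UPQ IPQ; apply/seteqP; split=> [x /polytope_joinP[t [p [t01 + ->]]]|x].
  by rewrite IPQ => -[? ?]; split; apply/polytope_joinP; exists t, p.
case=> /polytope_joinP[t [p [/andP[t0 t1] Pp xp]]] /polytope_joinP[s [q [/andP[s0 s1] Qq xq]]].
have aI : polytope_set (polytope_join a I) a.
  by rewrite /=; apply: sub_conv_hull; left.
have [tE|tN] := eqVneq t 1; first by rewrite xp tE subrr scale0r scale1r addr0.
have [sE|sN] := eqVneq s 1; first by rewrite xq sE subrr scale0r scale1r addr0.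
have {}t1 : 0 < 1 - t by rewrite subr_gt0 lt_neqAle tN.
have {}s1 : 0 < 1 - s by rewrite subr_gt0 lt_neqAle sN.
have [l /andP[l0 l1] lI] := segment_meet UPQ Pp Qq.
rewrite -IPQ in lI.
pose k := l / (1 - t) + (1 - l) / (1 - s).
have k1 : 1 <= k.
  have : l <= l / (1 - t) by rewrite ler_pdivlMr// ler_piMr//; lra.
  have : 1 - l <= (1 - l) / (1 - s) by rewrite ler_pdivlMr// ler_piMr//; lra.
  rewrite /k; lra.
have k0 : 0 < k by lra.
have pE : p = a + (1 - t)^-1 *: (x - a).
  apply/matrixP => i j; rewrite xp !mxE; field; rewrite gt_eqF//.
have qE : q = a + (1 - s)^-1 *: (x - a).
  apply/matrixP => i j; rewrite xq !mxE; field; rewrite gt_eqF//.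
have rE : l *: p + (1 - l) *: q = a + k *: (x - a).
  rewrite [in LHS]pE [in LHS]qE /k; apply/matrixP => i j; rewrite !mxE; field.
  by rewrite !gt_eqF.
apply/polytope_joinP; exists (1 - k^-1), (l *: p + (1 - l) *: q); split => //.
  by rewrite subr_ge0 invf_le1// k1 gerBl invr_ge0 ltW.
rewrite rE; apply/matrixP => i j; rewrite !mxE; field.
by rewrite gt_eqF.
Qed.

Lemma polytope_join_valuation a (Phi : polytope R n -> R) :
  is_valuation Phi -> is_valuation (fun P => Phi (polytope_join a P)).
Proof.
move=> vPhi P Q U I UPQ IPQ; apply: vPhi.
  exact: polytope_joinU.
exact: polytope_joinI UPQ IPQ.
Qed.

(** * Hausdorff distance of hulls and joins *)

Lemma enormZ (t : R) (x : 'cV[R]_n) : enorm (t *: x) = `|t| * enorm x.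
Proof.
rewrite /enorm -sqrtr_sqr -sqrtrM ?sqr_ge0//; congr Num.sqrt.
by rewrite mulr_sumr; apply: eq_bigr => i _; rewrite mxE exprMn.
Qed.

Lemma dist_to_convex P (e : R) : @convex_set R _ [set x | dist_to P x <= e].
Proof.
apply/convex_setP => x y t /= xe ye /andP[t0 t1].
apply/ler_addgt0Pr => d d0.
have [|x' Px' xx'] := @dist_to_lt _ _ P x (e + d); first by rewrite (le_lt_trans xe)// ltrDl.
have [|y' Py' yy'] := @dist_to_lt _ _ P y (e + d); first by rewrite (le_lt_trans ye)// ltrDl.
have Pxy : polytope_set P (t *: x' + (1 - t) *: y').
  by have /convex_setP := @polytope_convex _ _ P; apply => //; rewrite t0.
rewrite (le_trans (dist_to_le _ Pxy))// opprD addrACA -!scalerBr.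
rewrite (le_trans (ler_enormD _ _))// !enormZ (ger0_norm t0) ger0_norm ?subr_ge0//.
nra.
Qed.

(** Neighbourhoods of a convex set are convex, so Hausdorff distances can be tested on
    generators. *)
Lemma dist_to_hull P (F : set 'cV[R]_n) (e : R) :
  (forall x, F x -> dist_to P x <= e) -> forall x, conv_hull F x -> dist_to P x <= e.
Proof. by move=> Fe x; apply: (conv_hull_sub (@dist_to_convex P e)). Qed.

Lemma le_dist_to P Q x : P `<=` Q -> dist_to Q x <= dist_to P x.
Proof.
move=> PQ; apply/ler_addgt0Pr => d d0.
have [|y /PQ Qy xy] := @dist_to_lt _ _ P x (dist_to P x + d); first by rewrite ltrDl.
by rewrite (le_trans (dist_to_le _ Qy))// ltW.
Qed.

Lemma sub_polytope_join a P : P `<=` polytope_join a P.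
Proof. by move=> x Px; apply: sub_conv_hull; right. Qed.

Lemma hausdorff_join a P Q :
  hausdorff_dist (polytope_join a P) (polytope_join a Q) <= hausdorff_dist P Q.
Proof.
have H (A B : polytope R n) x : polytope_set (polytope_join a A) x ->
    dist_to (polytope_join a B) x <= hausdorff_dist A B.
  apply: dist_to_hull => y [->|Ay].
    rewrite (dist_to_eq0 _ _).2; last by apply: sub_conv_hull; left.
    by have [z Az] := polytope_neq0 A; rewrite (le_trans (dist_to_ge0 B z))//;
      have [+ _] := (hausdorff_distP A B _).1 (lexx _); apply.
  rewrite (le_trans (le_dist_to _ (@sub_polytope_join a B)))//.
  by have [+ _] := (hausdorff_distP A B _).1 (lexx _); apply.
apply/hausdorff_distP; split=> x; first exact: H.
by rewrite hausdorff_dist_sym; exact: H.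
Qed.

Lemma polytope_join_continuous a (Phi : polytope R n -> R) :
  continuous Phi -> continuous (fun P => Phi (polytope_join a P)).
Proof.
move=> cPhi P.
apply: (@continuous_comp _ _ _ (polytope_join a) Phi); last exact: cPhi.
move=> A /nbhs_ballP[e /= e0 eA]; apply/nbhs_ballP; exists e => //= Q.
rewrite ballEmdist/= => PQ; apply: eA; rewrite ballEmdist/=.
exact: le_lt_trans (hausdorff_join a P Q) PQ.
Qed.

(** * Combinations of the three functionals *)

Lemma V_n_valuation : is_valuation (fun P : polytope R n => V_n P).
Proof.
move=> P Q U I UPQ IPQ.
have mP := polytope_measurable P; have mQ := polytope_measurable Q.
have : @volume R n (P `|` Q) = (@volume R n P + @volume R n Q - @volume R n (P `&` Q))%E.
  by apply: measureUfinr => //; rewrite -ge0_fin_numE ?lebesgue_volume_ge0// polytope_volume_fin.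
rewrite -UPQ -IPQ /volume -!V_nK => /(congr1 fine)/= ->.
by rewrite subrK.
Qed.

Lemma V_n_SL_invariant : SL_invariant (fun P : polytope R n => V_n P).
Proof.
move=> A P dA; congr fine => /=.
have uA : A \in unitmx by rewrite unitmxE dA unitr1.
(* Volume preservation speaks of preimages, and the image under [A] is the preimage under its
   inverse. *)
rewrite -[RHS](@volume_preserving_det1 _ _ (invmx A)); last first.
- exact: polytope_measurable.
- by rewrite det_inv dA invr1.
congr lebesgue_volume; apply/seteqP; split=> [_ [x Px <-]|x /= Px].
  by rewrite /= mulKmx.
by exists (invmx A *m x) => //; rewrite mulKVmx.
Qed.

Lemma polytope_join0_SL_invariant (Phi : polytope R n -> R) :
  SL_invariant Phi -> SL_invariant (fun P => Phi (polytope_join 0 P)).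
Proof.
move=> sPhi A P dA; rewrite -[RHS](sPhi A)//; congr Phi; apply: polytope_inj => /=.
by rewrite -conv_hull_image image_setU image_set1 /= linear0.
Qed.

Lemma volume_combination_continuous (c0 cn dn : R) : continuous
  (fun P : polytope R n => c0 * V_0 P + cn * V_n P + dn * V_n (polytope_join 0 P)).
Proof.
have cJ := polytope_join_continuous (a := 0) (@V_n_continuous R n).
move=> P.
apply: (@continuousD _ _ (polytope R n) (fun P => c0 * V_0 P + cn * V_n P) (fun P => dn * V_n (polytope_join 0 P))).
  apply: (@continuousD _ _ (polytope R n) (fun P => c0 * V_0 P) (fun P => cn * V_n P)).
    exact: cst_continuous.
  apply: (@continuousM _ (polytope R n) (fun=> cn) (fun P => V_n P)); [exact: cst_continuous|exact: V_n_continuous].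
apply: (@continuousM _ (polytope R n) (fun=> dn) _); [exact: cst_continuous|exact: cJ].
Qed.

Lemma volume_combination_valuation (c0 cn dn : R) (Psi : polytope R n -> R) :
  (forall P, Psi P = c0 * V_0 P + cn * V_n P + dn * V_n (polytope_join 0 P)) ->
  [/\ continuous Psi, SL_invariant Psi & is_valuation Psi].
Proof.
move=> /funext ->; split.
- exact: volume_combination_continuous.
- move=> A P dA; rewrite /V_0 V_n_SL_invariant//.
  by rewrite (polytope_join0_SL_invariant V_n_SL_invariant).
- move=> P Q U I UPQ IPQ.
  have := V_n_valuation UPQ IPQ; have := polytope_join_valuation 0 V_n_valuation UPQ IPQ.
  rewrite /V_0 => e1 e2.
  have := congr1 (fun z => cn * z) e2; have := congr1 (fun z => dn * z) e1 => /=.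
  by rewrite !mulrDr => ? ?; lra.
Qed.

End Join.

(** * Cutting convex hulls *)

Section Hulls.
Variables (R : realType) (n : nat).
Local Notation V := 'cV[R]_n.
Implicit Types (P Q U I : polytope R n) (a b v w x : V) (s X : seq V).

Lemma hull_subproof s : exists F : set V, [/\ finite_set F, F !=set0 &
  conv_hull [set` if nilp s then [:: 0] else s] = conv_hull F].
Proof.
exists [set` if nilp s then [:: 0] else s]; split => //; first exact: finite_seq.
by case: s => [|a s]; [exists 0|exists a]; rewrite /= mem_head.
Qed.

(* The empty list has the junk value {0}. *)
Definition hull s : polytope R n := Polytope (hull_subproof s).

Lemma hullE a s : (hull (a :: s) : set V) = conv_hull [set` a :: s].
Proof. by []. Qed.

Lemma eq_hull s (t : seq V) : s =i t -> hull s = hull t.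
Proof.
move=> st; apply: polytope_inj => /=.
have -> : nilp s = nilp t.
  case: s t st => [|a s] [|b t]//= st.
    by have := st b; rewrite mem_head in_nil.
  by have := st a; rewrite mem_head in_nil.
by case: (nilp t) => //; congr conv_hull; apply/seteqP; split => x /=; rewrite st.
Qed.

Lemma perm_hull s (t : seq V) : perm_eq s t -> hull s = hull t.
Proof. by move=> /perm_mem/eq_hull. Qed.

Lemma sub_hull s x : x \in s -> (hull s : set V) x.
Proof. by case: s => [//|a s] xs; exact: sub_conv_hull. Qed.

Lemma hull_sub s (C : set V) : s != [::] -> @convex_set R _ C ->
  (forall x, x \in s -> C x) -> hull s `<=` C.
Proof. by case: s => [//|a s] _ cC sC; exact: conv_hull_sub. Qed.

Lemma hull_cons a s x : s != [::] -> (hull (a :: s) : set V) x <->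
  exists t y, [/\ 0 <= t <= 1, (hull s : set V) y & x = t *: a + (1 - t) *: y].
Proof.
move=> s0; rewrite -polytope_joinP.
suff -> : hull (a :: s) = polytope_join a (hull s) by [].
apply: polytope_inj; case: s s0 => [//|b s _] /=; rewrite conv_hullUr; congr conv_hull.
by apply/seteqP; split => y /=; rewrite !inE; [move=> /predU1P|move=> -[->|/= ->]]; rewrite ?eqxx ?orbT.
Qed.

Lemma join_hull a s : s != [::] -> polytope_join a (hull s) = hull (a :: s).
Proof.
move=> s0; apply: polytope_inj; apply/seteqP; split => x.
  by move=> /polytope_joinP ?; apply/hull_cons.
by move=> /(hull_cons _ _ s0) ?; apply/polytope_joinP.
Qed.

Lemma polytope_hull P : exists2 s, s != [::] & P = hull s.
Proof.
have [F [/finite_seqP[s ->] [x xs] PE]] := polytopeP P; exists s.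
  by apply: contraPneq xs => -> /=.
by apply: polytope_inj; rewrite PE; case: s xs {PE}.
Qed.

Definition affine (f : V -> R) :=
  forall t x y, f (t *: x + (1 - t) *: y) = t * f x + (1 - t) * f y.

Lemma convex_affine_ge0 f : affine f -> @convex_set R _ [set x | 0 <= f x].
Proof.
move=> af; apply/convex_setP => x y t /= fx fy /andP[t0 t1]; rewrite af.
by rewrite addr_ge0// mulr_ge0// subr_ge0.
Qed.

Lemma convex_comb (C : set V) (s : seq (R * V)) : @convex_set R _ C ->
  (forall p, p \in s -> 0 <= p.1 /\ C p.2) ->
  \sum_(p <- s) p.1 = 1 -> C (\sum_(p <- s) p.1 *: p.2).
Proof.
(* Tails of the list do not have coefficient sum 1, so the induction runs on normalised sums. A tail
   with sum 0 has only zero coefficients. *)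
move=> /convex_setP cC; suff H : (forall p, p \in s -> 0 <= p.1 /\ C p.2) ->
    0 < \sum_(p <- s) p.1 ->
    C ((\sum_(p <- s) p.1)^-1 *: \sum_(p <- s) p.1 *: p.2).
  by move=> /H + s1; rewrite s1 invr1 scale1r; apply; exact: ltr01.
elim: s => [_|[c x] s IH cs]; first by rewrite big_nil ltxx.
have [c0 Cx] := cs _ (mem_head _ _); rewrite !big_cons/= in c0 Cx *.
have cs' p : p \in s -> 0 <= p.1 /\ C p.2 by move=> ps; apply: cs; rewrite inE ps orbT.
set S := \sum_(_ <- _) _; set T := \sum_(_ <- _) _ *: _.
have S0 : 0 <= S by rewrite /S big_seq sumr_ge0// => p /cs'[].
move=> cS; have [SE|SN] := eqVneq S 0.
  have T0 : T = 0.
    rewrite /T big_seq big1// => p ps.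
    have := SE => /eqP; rewrite /S big_seq psumr_eq0 => [|q /cs'[]//].
    by move=> /allP/(_ p ps); rewrite ps => /eqP ->; rewrite scale0r.
  by rewrite SE T0 !addr0 scalerA mulVf ?scale1r// gt_eqF//; rewrite SE addr0 in cS.
have {}S0 : 0 < S by rewrite lt_def SN.
have := cC x _ (c / (c + S)) Cx (IH cs' S0); rewrite -/S -/T => H.
rewrite (_ : _ *: (_ + _) = c / (c + S) *: x + (1 - c / (c + S)) *: (S^-1 *: T)).
  by apply: H; rewrite divr_ge0 ?(ltW cS)// ler_pdivrMr// mul1r lerDl ltW.
rewrite scalerDr !scalerA [_^-1 * c]mulrC; congr (_ + _ *: _).
by field; rewrite SN gt_eqF.
Qed.

Lemma convex3 (C : set V) (c1 c2 c3 : R) x y z : @convex_set R _ C ->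
  C x -> C y -> C z -> 0 <= c1 -> 0 <= c2 -> 0 <= c3 -> c1 + c2 + c3 = 1 ->
  C (c1 *: x + c2 *: y + c3 *: z).
Proof.
move=> cC Cx Cy Cz p1 p2 p3 s1.
have := @convex_comb C [:: (c1, x); (c2, y); (c3, z)] cC.
rewrite !big_cons !big_nil !addr0 !addrA; apply=> // p.
by rewrite !inE => /or3P[] /eqP ->.
Qed.

(* Cutting by the hyperplane [f = 0], which contains [w] and [X]. *)
Lemma split_hull (Phi : polytope R n -> R) a b (l : R) X (f : V -> R) :
  is_valuation Phi -> affine f -> 0 < l < 1 ->
  let w := l *: a + (1 - l) *: b in
  0 < f a -> f w = 0 -> (forall x, x \in X -> f x = 0) ->
  Phi (hull [:: a, w & X]) + Phi (hull [:: w, b & X]) =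
  Phi (hull [:: a, b & X]) + Phi (hull (w :: X)).
Proof.
move=> vPhi af /andP[l0 l1] w fa fw fX.
have l10 : 0 < 1 - l by rewrite subr_gt0.
have fb : f b <= 0 by move: fw; rewrite af => ?; nra.
have hc s : @convex_set R _ (hull s : set V) by exact: polytope_convex.
have wab s : a \in s -> b \in s -> (hull s : set V) w.
  move=> sa sb; have /convex_setP H := hc s; apply: H; rewrite ?ltW//; try exact: sub_hull.
apply: vPhi; apply/seteqP; split => x.
(* Adding [w] to the generators keeps the remaining list nonempty when [X] is empty. *)
- suff : (hull [:: a, b, w & X] : set V) x -> (hull [:: a, w & X] `|` hull [:: w, b & X]) x.
    move=> H abX; apply: H; move: x abX; apply: hull_sub => // x xs.
    by apply: sub_hull; move: xs; rewrite !inE => /or3P[] ->; rewrite ?orbT.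
  move=> /hull_cons -/(_ isT)[t [y [/andP[t0 t1] + ->]]].
  move=> /hull_cons -/(_ isT)[u [z [/andP[u0 u1] zX ->]]].
  have zaw : (hull [:: a, w & X] : set V) z.
    move: z zX; apply: hull_sub => // z zX; apply: sub_hull.
    by rewrite inE zX orbT.
  have zwb : (hull [:: w, b & X] : set V) z.
    move: z zX {zaw}; apply: hull_sub => // z zX; apply: sub_hull.
    by move: zX; rewrite !inE => /orP[] ->; rewrite ?orbT.
  (* Weight on [a] and [b] is traded for weight on [w], in the ratio [l] to [1 - l], until one of
     the two is used up. *)
  have [le|lt] := leP ((1 - t) * u * l) (t * (1 - l)).
    left; rewrite (_ : _ + _ = (t - (1 - t) * u * l / (1 - l)) *: a +
        ((1 - t) * u / (1 - l)) *: w + ((1 - t) * (1 - u)) *: z).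
      apply: convex3 => //; try by [apply: sub_hull; rewrite !inE eqxx ?orbT].
      - by rewrite subr_ge0 ler_pdivrMr.
      - by rewrite divr_ge0 ?mulr_ge0 ?subr_ge0 ?(ltW l1).
      - by rewrite mulr_ge0// subr_ge0.
      - by field; rewrite gt_eqF.
    by apply/matrixP => i j; rewrite !mxE; field; rewrite gt_eqF.
  right; rewrite (_ : _ + _ = (t / l) *: w +
      ((1 - t) * u - t * (1 - l) / l) *: b + ((1 - t) * (1 - u)) *: z).
    apply: convex3 => //; try by [apply: sub_hull; rewrite !inE eqxx ?orbT].
    - by rewrite divr_ge0 ?(ltW l0).
    - by rewrite subr_ge0 ler_pdivrMr// ltW.
    - by rewrite mulr_ge0// subr_ge0.
    - by field; rewrite gt_eqF.
  by apply/matrixP => i j; rewrite !mxE; field; rewrite gt_eqF.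
- case; move: x; apply: hull_sub => // x; rewrite inE => /predU1P[->|].
  + by apply: sub_hull; rewrite mem_head.
  + rewrite inE => /predU1P[->|xX]; first by apply: wab; rewrite !inE eqxx ?orbT.
    by apply: sub_hull; rewrite !inE xX !orbT.
  + by apply: wab; rewrite !inE eqxx ?orbT.
  + by rewrite inE => xs; apply: sub_hull; rewrite !inE xs orbT.
- move: x; apply: hull_sub => //.
    apply/convex_setP => x y t [ax bx] [ay yb] t01.
    by have /convex_setP H := hc [:: a, w & X]; have /convex_setP H' := hc [:: w, b & X];
      split; [exact: H|exact: H'].
  move=> x; rewrite inE => /predU1P[->|xX].
    by split; apply: sub_hull; rewrite !inE eqxx ?orbT.
  by split; apply: sub_hull; rewrite !inE xX ?orbT.
(* The value of [f] at the point is [t * f a], because [f] vanishes on [hull (w :: X)]. On the side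
   of [b] it is nonpositive, so [t = 0]. *)
move=> [/hull_cons -/(_ isT)[t [y [/andP[t0 t1] wXy ->]]] xb].
have afN : affine (fun z => - f z) by move=> *; rewrite af; ring.
have wX0 : hull (w :: X) `<=` [set z | 0 <= f z].
  apply: hull_sub => [//||z]; first exact: convex_affine_ge0.
  by rewrite inE /= => /predU1P[->|/fX ->]; rewrite ?fw.
have wX0' : hull (w :: X) `<=` [set z | 0 <= - f z].
  apply: hull_sub => [//||z]; first exact: convex_affine_ge0.
  by rewrite inE /= => /predU1P[->|/fX ->]; rewrite ?fw oppr0.
have fy : f y = 0.
  by apply/eqP; rewrite eq_le -oppr_ge0; apply/andP; split; [exact: wX0'|exact: wX0].
have : hull [:: w, b & X] `<=` [set z | 0 <= - f z].
  apply: hull_sub => [//||z]; first exact: convex_affine_ge0.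
  rewrite !inE /= => /or3P[/eqP ->|/eqP ->|/fX ->]; rewrite ?fw ?oppr0//.
  by rewrite oppr_ge0.
move=> /(_ _ xb) /=.
rewrite af fy mulr0 addr0 oppr_ge0 pmulr_lle0// => t0'.
have -> : t = 0 by apply/eqP; rewrite eq_le t0' t0.
by rewrite scale0r add0r subr0 scale1r.
Qed.

End Hulls.

(** * Valuations vanishing on simplices *)

Section Free.
Variables (R : realType) (U : vectType R).
Implicit Types (s X : seq U) (x y z : U).

(** Pairs of coefficient and vector replace indexed families, so that dependences can be permuted,
    filtered and extended like lists. *)
Lemma free_pairsP s : free s <->
  forall t : seq (R * U), map snd t = s -> \sum_(p <- t) p.1 *: p.2 = 0 ->
    forall p, p \in t -> p.1 = 0.
Proof.
split=> [/(@freeP _ _ _ (in_tuple s)) fs t ts t0 p|H].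
  have st : size t = size s by rewrite -ts size_map.
  move=> /(nthP (0, 0))[i it <-].
  have is_ : (i < size s)%N by rewrite -st.
  apply: (fs (fun j => (nth (0, 0) t j).1) _ (Ordinal is_)).
  rewrite -[RHS]t0 (big_nth (0, 0)) big_mkord st; apply: eq_bigr => j _ /=.
  by congr (_ *: _); rewrite -(nth_map _ 0) ?ts ?st.
apply/(@freeP _ _ _ (in_tuple s)) => k k0 i.
have := H [seq (k j, s`_j) | j : 'I_(size s)].
rewrite /= -map_comp (_ : map _ _ = s); last first.
  apply: (@eq_from_nth _ 0); rewrite size_map size_enum_ord// => j js.
  by rewrite (nth_map (Ordinal js)) ?size_enum_ord//= nth_enum_ord.
rewrite big_map big_enum/= => /(_ erefl k0 (k i, s`_i)); apply.
by apply/mapP; exists i => //; rewrite mem_enum.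
Qed.

Lemma free_exchange x y z X (c : R) : free (x :: X) -> c != 0 ->
  y = c *: x + z -> z \in <<X>>%VS -> free (y :: X).
Proof.
rewrite !free_cons => /andP[xX ->] c0 yE zX; rewrite andbT.
apply: contra xX => yX.
have -> : x = c^-1 *: (y - z) by rewrite yE addrK scalerA mulVf// scale1r.
by rewrite rpredZ// rpredB.
Qed.

(** The coordinate along [x]. The cutting hyperplanes are zero sets of such functionals, on the
    space itself or in homogeneous coordinates, or of combinations of two of them. *)
Lemma free_dual x X : free (x :: X) ->
  exists phi : {linear U -> R^o}, phi x = 1 /\ forall y, y \in X -> phi y = 0.
Proof.
move=> fX; exists (coord (in_tuple (x :: X)) ord0); split.
  exact: (@coord_free _ _ _ (in_tuple (x :: X)) ord0 ord0 fX).
move=> y /(nthP 0)[i iX <-].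
have iX' : (i.+1 < size (x :: X))%N by [].
exact: (@coord_free _ _ _ (in_tuple (x :: X)) (Ordinal iX') ord0 fX).
Qed.

End Free.

Section Uniqueness.
Variables (R : realType) (n : nat).
Local Notation V := 'cV[R]_n.
Implicit Types (P Q : polytope R n) (a b v w x : V) (X : seq V) (s : seq (R * V)).

(** Homogeneous coordinates: affine relations between points are the linear relations between their
    lifts. *)
Definition lift1 x : 'cV[R]_(1 + n) := col_mx 1%:M x.

Definition affinely_free X := free (map lift1 X).

Lemma lift1_affine (t : R) x y :
  lift1 (t *: x + (1 - t) *: y) = t *: lift1 x + (1 - t) *: lift1 y.
Proof.
by rewrite /lift1 !scale_col_mx add_col_mx -scalerDl [t + _]addrC subrK scale1r.
Qed.

Lemma affine_lift1 (phi : {linear 'cV[R]_(1 + n) -> R^o}) :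
  affine (fun x => phi (lift1 x)).
Proof. by move=> t x y; rewrite lift1_affine linearD !linearZ. Qed.

Lemma sum_lift1 s : \sum_(p <- s) p.1 *: lift1 p.2 =
  col_mx (\sum_(p <- s) p.1)%:M (\sum_(p <- s) p.1 *: p.2).
Proof.
elim: s => [|p s IH]; first by rewrite !big_nil raddf0 col_mx0.
by rewrite !big_cons IH /lift1 scale_col_mx add_col_mx scale_scalar_mx mulr1 raddfD.
Qed.

Lemma lift1_comb s v : lift1 v = \sum_(p <- s) p.1 *: lift1 p.2 <->
  \sum_(p <- s) p.1 = 1 /\ v = \sum_(p <- s) p.1 *: p.2.
Proof.
rewrite sum_lift1.
split=> [/eq_col_mx[/matrixP/(_ 0 0) + ->]|[-> ->]//].
by rewrite !mxE.
Qed.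

Lemma perm_affinely_free X Y : perm_eq X Y -> affinely_free X = affinely_free Y.
Proof. by move=> XY; apply: perm_free; apply: perm_map. Qed.

Lemma affinely_free_tl x X : affinely_free (x :: X) -> affinely_free X.
Proof. by rewrite /affinely_free/= free_cons => /andP[]. Qed.

Lemma affinely_free_swap x y X : affinely_free (x :: y :: X) = affinely_free (y :: x :: X).
Proof. by apply: perm_affinely_free; exact: (permEl (perm_catCA [:: x] [:: y] X)). Qed.

Lemma affinely_free_exchange x y X (c : R) s : affinely_free (x :: X) -> c != 0 ->
  {subset map snd s <= X} ->
  lift1 y = c *: lift1 x + \sum_(p <- s) p.1 *: lift1 p.2 -> affinely_free (y :: X).
Proof.
move=> fX c0 sX yE; apply: (free_exchange fX c0 yE).
rewrite big_seq; apply: rpred_sum => p ps; apply: rpredZ; apply: memv_span.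
by apply: map_f; apply: sX; apply: map_f.
Qed.

Lemma affinely_free_dual x X : affinely_free (x :: X) -> exists f : V -> R,
  [/\ affine f, f x = 1, forall y, y \in X -> f y = 0 &
    forall y s, lift1 y = \sum_(p <- s) p.1 *: lift1 p.2 -> f y = \sum_(p <- s) p.1 * f p.2].
Proof.
move=> /free_dual[phi [phix phiX]]; exists (fun x => phi (lift1 x)); split => //.
- exact: affine_lift1.
- by move=> y yX; apply: phiX; exact: map_f.
- by move=> y s ->; rewrite linear_sum; apply: eq_bigr => p _; rewrite linearZ.
Qed.

(** A linear relation becomes an affine one when the origin receives minus the sum of the
    coefficients. *)
Lemma free_of_affinely_free0 X : affinely_free (0 :: X) -> free X.
Proof.
move=> /free_pairsP H; apply/free_pairsP => t tX t0 p pt.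
have [t1|t1] := eqVneq p.1 0; first by [].
pose t' := (- \sum_(q <- t) q.1, lift1 0) :: [seq (q.1, lift1 q.2) | q <- t].
apply: (H t' _ _ (p.1, lift1 p.2)).
- by rewrite /t'/= -map_comp -tX -[in RHS]map_comp.
- rewrite big_cons big_map /=.
  suff -> : \sum_(q <- t) q.1 *: lift1 q.2 = (\sum_(q <- t) q.1) *: lift1 0.
    by rewrite scaleNr addNr.
  rewrite -[RHS]addr0 -[X in _ + X](_ : col_mx 0 (\sum_(q <- t) q.1 *: q.2) = 0); last first.
    by rewrite t0 col_mx0.
  elim: t {tX t0 pt t'} => [|q t IH]; first by rewrite !big_nil scale0r col_mx0 addr0.
  rewrite !big_cons IH /lift1 !scale_col_mx !add_col_mx !scaler0 !addr0 !add0r.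
  by rewrite scalerDl.
by rewrite inE; apply/orP; right; apply/mapP; exists p.
Qed.

Section Vanishing.
Variable Phi : polytope R n -> R.
Hypothesis vPhi : is_valuation Phi.

(* [v] and a point with a negative coefficient are replaced by the point where their
   segment meets the affine hull of the other points. *)
Lemma circuit_vanish : (forall X, X != [::] -> affinely_free X -> Phi (hull X) = 0) ->
  forall k s v, (count (fun p => (p.1 < 0)%R) s <= k)%N -> affinely_free (map snd s) ->
    lift1 v = \sum_(p <- s) p.1 *: lift1 p.2 -> Phi (hull (v :: map snd s)) = 0.
Proof.
move=> simp; elim=> [|k IH] s v sk fs vE.
  have [s1 vs] := (lift1_comb s v).1 vE.
  have s0 : map snd s != [::].
    by case: s s1 {sk fs vE vs} => // /eqP; rewrite big_nil eq_sym oner_eq0.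
  (* Without negative coefficients [v] is a convex combination of the other points. *)
  suff -> : hull (v :: map snd s) = hull (map snd s) by exact: simp.
  rewrite -join_hull//; apply: polytope_inj; apply/seteqP; split; last exact: sub_polytope_join.
  move=> x /polytope_joinP[t [p [t01 Pp ->]]].
  have cs := @polytope_convex _ _ (hull (map snd s)).
  move/convex_setP: (cs); apply => //; rewrite vs; apply: convex_comb => // q qs.
  split; last by apply: sub_hull; exact: map_f.
  have := sk; rewrite leqNgt -has_count => /hasPn/(_ q qs).
  by rewrite -leNgt.
have [/hasP[[be b] bs /= be0]|hs] := boolP (has (fun p => p.1 < 0) s); last first.
  by apply: IH => //; move: hs; rewrite has_count -eqn0Ngt => /eqP ->.
pose s' := rem (be, b) s.
have ss' : perm_eq s ((be, b) :: s') by exact: perm_to_rem.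
pose X := map snd s'.
have sX : perm_eq (map snd s) (b :: X) by rewrite -[b]/((be, b).2) -map_cons perm_map.
rewrite (perm_affinely_free sX) in fs.
rewrite (perm_big _ ss') big_cons/= in vE.
have be1 : 0 < 1 - be by lra.
(* The weight of [v] for which the coefficient [l * be + (1 - l)] of [b] in [w] vanishes. *)
pose l := (1 - be)^-1.
have l0 : 0 < l by rewrite invr_gt0.
have l1 : l < 1 by rewrite invf_lt1//; lra.
have lbe : l * be + (1 - l) = 0.
  by rewrite /l; field; rewrite gt_eqF.
pose w := (1 - l) *: b + (1 - (1 - l)) *: v.
pose s'' := [seq (l * p.1, p.2) | p <- s'].
have s''X : map snd s'' = X by rewrite -map_comp.
have wE : lift1 w = \sum_(p <- s'') p.1 *: lift1 p.2.
  rewrite big_map /= lift1_affine vE subKr scalerDr scalerA addrA -scalerDl [1 - l + _]addrC lbe.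
  by rewrite scale0r add0r scaler_sumr; apply: eq_bigr => p _; rewrite scalerA.
have ck : (count (fun p => (p.1 < 0)%R) s'' <= k)%N.
  have := sk; rewrite (permP ss') /= be0 add1n ltnS; apply: leq_trans.
  rewrite count_map; apply: sub_count => p /=; by rewrite pmulr_rlt0.
have fX := affinely_free_tl fs.
have [f [af fb fX0 flin]] := affinely_free_dual fs.
have fw : f w = 0.
  rewrite (flin _ _ wE) big_seq big1// => p ps; rewrite fX0 ?mulr0// -s''X.
  exact: map_f.
have l01 : 0 < 1 - l < 1 by apply/andP; split; lra.
have := @split_hull _ _ Phi b v (1 - l) X f vPhi af l01.
rewrite /= -/w fb ltr01 fw => /(_ isT erefl fX0).
(* In the other three bodies [w] has a negative coefficient less: [b] and [v] enter with coefficient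
   0, and [v] may replace [b] in the simplex because [be] is nonzero. *)
have -> : Phi (hull (w :: X)) = 0 by rewrite -s''X; apply: IH => //; rewrite s''X.
have -> : hull [:: b, w & X] = hull [:: w, b & X] by apply: eq_hull => x; rewrite !inE orbCA.
have -> : Phi (hull [:: w, b & X]) = 0.
  have := IH ((0, b) :: s'') w; rewrite /= s''X ltxx; apply => //.
  by rewrite big_cons scale0r add0r.
have -> : Phi (hull [:: w, v & X]) = 0.
  have := IH ((0, v) :: s'') w; rewrite /= s''X ltxx; apply => //; last by rewrite big_cons scale0r add0r.
  apply: (affinely_free_exchange (c := be) (s := s') fs) => //.
  by rewrite lt_eqF.
rewrite !addr0 => /esym; congr (Phi _ = 0); apply: eq_hull => x.
by rewrite !inE (perm_mem sX) inE orbCA.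
Qed.

(* Two points with coefficients of the same sign are replaced by their barycenter. *)
Lemma same_sign_step p1 p2 s :
  (forall t, (count (fun p => (p.1 != 0)%R) t < count (fun p => (p.1 != 0)%R) [:: p1, p2 & s])%N ->
    affinely_free (map snd t) -> lift1 0 = \sum_(p <- t) p.1 *: lift1 p.2 ->
    Phi (hull (map snd t)) = 0) ->
  0 < p1.1 * p2.1 -> affinely_free (map snd [:: p1, p2 & s]) ->
  lift1 0 = \sum_(p <- [:: p1, p2 & s]) p.1 *: lift1 p.2 ->
  Phi (hull (map snd [:: p1, p2 & s])) = 0.
Proof.
case: p1 p2 => [c1 a] [c2 b] /= IH c12 fabX sE.
set X := map snd s in fabX *.
have c1N : c1 != 0 by apply: contraTneq c12 => ->; rewrite mul0r ltxx.
have c2N : c2 != 0 by apply: contraTneq c12 => ->; rewrite mulr0 ltxx.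
have cN : c1 + c2 != 0.
  apply: contraTneq c12 => c0; rewrite -leNgt.
  have -> : c1 = - c2 by apply/eqP; rewrite -addr_eq0 c0.
  by rewrite mulNr oppr_le0 -expr2 sqr_ge0.
have fbaX : affinely_free [:: b, a & X] by rewrite affinely_free_swap.
pose l := c1 / (c1 + c2).
have l1E : 1 - l = c2 / (c1 + c2) by rewrite /l; field.
have l01 : 0 < l < 1.
  (* Both coefficients may be negative; with the squared denominator the two signs need no separate
     treatment. *)
  have c0 : 0 < (c1 + c2) ^+ 2 by rewrite lt_def sqr_ge0 sqrf_eq0 cN.
  have -> : l = (c1 ^+ 2 + c1 * c2) / (c1 + c2) ^+ 2 by rewrite /l; field.
  have c22 : 0 < c2 ^+ 2 by rewrite lt_def sqr_ge0 sqrf_eq0 c2N.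
  apply/andP; split; first by rewrite divr_gt0// ltr_wpDl ?sqr_ge0.
  rewrite ltr_pdivrMr// mul1r -subr_gt0.
  by rewrite (_ : _ - _ = c1 * c2 + c2 ^+ 2) ?addr_gt0//; ring.
have /andP[l0 l1] := l01.
pose w := l *: a + (1 - l) *: b.
have cw : (c1 + c2) *: lift1 w = c1 *: lift1 a + c2 *: lift1 b.
  by rewrite lift1_affine scalerDr !scalerA l1E /l !mulrA ![(c1 + c2) * _]mulrC !mulfK.
have sw : lift1 0 = (c1 + c2) *: lift1 w + \sum_(p <- s) p.1 *: lift1 p.2.
  by rewrite cw sE !big_cons /= addrA.
have fwaX : affinely_free [:: w, a & X].
  apply: (affinely_free_exchange (c := 1 - l) (s := [:: (l, a)]) fbaX).
  - by rewrite subr_eq0 gt_eqF.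
  - by move=> x; rewrite /= !inE => /eqP ->; rewrite eqxx.
  - by rewrite big_seq1/= lift1_affine addrC.
have fwbX : affinely_free [:: w, b & X].
  apply: (affinely_free_exchange (c := l) (s := [:: (1 - l, b)]) fabX).
  - by rewrite gt_eqF.
  - by move=> x; rewrite /= !inE => /eqP ->; rewrite eqxx.
  - by rewrite big_seq1/= lift1_affine.
have [f [af fa faX _]] := affinely_free_dual fabX.
have [g [ag gb gbX _]] := affinely_free_dual fbaX.
have fb : f b = 0 by apply: faX; rewrite mem_head.
have ga : g a = 0 by apply: gbX; rewrite mem_head.
(* Already [c2 * f x - c1 * g x] vanishes at [w]; the further factor [c2] makes the value at [a]
   positive for either sign. *)
pose h x := c2 ^+ 2 * f x - c1 * c2 * g x.
have ah : affine h by move=> t x y; rewrite /h af ag; ring.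
have ha : 0 < h a by rewrite /h fa ga mulr0 subr0 mulr1 lt_def sqr_ge0 sqrf_eq0 c2N.
have hw : h w = 0 by rewrite ah /h fa fb ga gb l1E /l; field.
have hX x : x \in X -> h x = 0.
  by move=> xX; rewrite /h faX ?gbX ?mulr0 ?subr0// inE xX orbT.
have := @split_hull _ _ Phi a b l X h vPhi ah l01.
rewrite /= -/w => /(_ ha hw hX).
have fwX : affinely_free (w :: X).
  by apply: (@affinely_free_tl a); rewrite affinely_free_swap.
(* In the other three bodies [w] carries [c1 + c2] and a remaining [a] or [b] carries 0, so one
   nonzero coefficient is lost. *)
have -> : Phi (hull (w :: X)) = 0.
  by apply: (IH ((c1 + c2, w) :: s)); rewrite /= ?c1N ?c2N ?cN ?big_cons.
have -> : Phi (hull [:: a, w & X]) = 0.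
  apply: (IH [:: (0, a), (c1 + c2, w) & s]); rewrite /= ?eqxx ?c1N ?c2N ?cN//.
    by rewrite affinely_free_swap.
  by rewrite !big_cons scale0r add0r.
have -> : Phi (hull [:: w, b & X]) = 0.
  apply: (IH [:: (c1 + c2, w), (0, b) & s]); rewrite /= ?eqxx ?c1N ?c2N ?cN//.
  by rewrite !big_cons scale0r add0r.
by rewrite !addr0.
Qed.

(** Induction on the number of nonzero barycentric coordinates of the origin. Once no two share a
    sign, either the origin is a vertex, or one positive and one negative coordinate are left and
    the origin is collinear with those two vertices. *)
Lemma simplex_vanish :
  (forall X, free X -> Phi (hull (0 :: X)) = 0) ->
  (forall X, X != [::] -> free X -> Phi (hull X) = 0) ->
  forall X, X != [::] -> affinely_free X -> Phi (hull X) = 0.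
Proof.
move=> PhiA PhiB X X0 afX.
have [fX|nfX] := boolP (free X); first exact: PhiB.
suff core : forall k s, (count (fun p => (p.1 != 0)%R) s < k)%N ->
    affinely_free (map snd s) -> lift1 0 = \sum_(p <- s) p.1 *: lift1 p.2 ->
    Phi (hull (map snd s)) = 0.
  have [s [sX [s0 [p ps p0]]]] : exists s : seq (R * V), map snd s = X /\
      (\sum_(p <- s) p.1 *: p.2 = 0 /\ exists2 p, p \in s & p.1 != 0).
    apply: contrapT => no; move/negP: nfX; apply; apply/free_pairsP => t tX t0 p pt.
    by apply/eqP/negPn/negP => pN; apply: no; exists t; split => //; split => //; exists p.
  (* A linear dependence with coefficient sum 0 would be an affine one. So the sum can be scaled to
     1, which gives the barycentric coordinates of the origin. *)
  have S0 : \sum_(q <- s) q.1 != 0.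
    apply: contra_neq p0 => S0.
    apply: ((free_pairsP _).1 afX [seq (q.1, lift1 q.2) | q <- s] _ _ (p.1, lift1 p.2)).
    - by rewrite -sX -!map_comp.
    - by rewrite big_map /= sum_lift1 S0 s0 raddf0 col_mx0.
    - by apply/mapP; exists p.
  set S := \sum_(q <- s) q.1 in S0.
  have := core (count (fun p => (p.1 != 0)%R) [seq (S^-1 * q.1, q.2) | q <- s]).+1
    [seq (S^-1 * q.1, q.2) | q <- s] (leqnn _).
  rewrite -map_comp sX; apply => //.
  apply/lift1_comb; rewrite !big_map/= -mulr_sumr mulVf//; split => //.
  by under eq_bigr do rewrite -scalerA; rewrite -scaler_sumr s0 scaler0.
move=> {X X0 afX nfX}; elim=> [//|k IH] s sk fs sE.
have step p1 p2 t : perm_eq s [:: p1, p2 & t] -> 0 < p1.1 * p2.1 -> Phi (hull (map snd s)) = 0.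
  move=> st p12; have sX := perm_map snd st.
  rewrite (perm_hull sX); apply: same_sign_step => //.
  - by move=> t' t'lt; apply: IH; rewrite -ltnS (leq_trans _ sk)// ltnS (permP st).
  - by rewrite -(perm_affinely_free sX).
  - by rewrite sE (perm_big _ st).
pose pos := seq.filter (fun p : R * V => 0 < p.1) s.
pose npos := seq.filter (predC (fun p : R * V => 0 < p.1)) s.
pose neg := seq.filter (fun p : R * V => p.1 < 0) npos.
pose zer := seq.filter (predC (fun p : R * V => p.1 < 0)) npos.
have snp : perm_eq s (pos ++ npos) by rewrite perm_sym; exact: (permEl (perm_filterC _ _)).
have npz : perm_eq npos (neg ++ zer) by rewrite perm_sym; exact: (permEl (perm_filterC _ _)).
have spnz : perm_eq s (pos ++ neg ++ zer) by apply: (perm_trans snp); rewrite perm_cat2l.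
have snpz : perm_eq s (neg ++ pos ++ zer).
  by apply: (perm_trans spnz); exact: (permEl (perm_catCA _ _ _)).
have pos0 p : p \in pos -> 0 < p.1 by rewrite mem_filter => /andP[].
have neg0 p : p \in neg -> p.1 < 0 by rewrite mem_filter => /andP[].
have zer0 p : p \in zer -> p.1 = 0.
  rewrite !mem_filter/= => /and3P[p1 p2 _]; apply/eqP; rewrite eq_le.
  by rewrite leNgt p2 leNgt p1.
have [s1 s0] := (lift1_comb s 0).1 sE.
have z1 : \sum_(p <- zer) p.1 = 0 by rewrite big_seq big1.
have zl : \sum_(p <- zer) p.1 *: lift1 p.2 = 0.
  by rewrite big_seq big1// => p /zer0 ->; rewrite scale0r.
case: pos => [|[c1 a] [|p2 r]] in pos0 spnz snpz snp; last first.
- by apply: (step _ _ _ spnz); rewrite mulr_gt0// pos0// !inE eqxx ?orbT.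
- have c10 : 0 < c1 by apply: (pos0 (c1, a)); rewrite mem_head.
  case: neg => [|[c2 b] [|p2 r]] in neg0 spnz snpz npz; last first.
  + by apply: (step _ _ _ snpz); rewrite nmulr_rgt0 neg0// !inE eqxx ?orbT.
  + have c20 : c2 < 0 by apply: (neg0 (c2, b)); rewrite mem_head.
    set Z := map snd zer.
    have sX : perm_eq (map snd s) [:: a, b & Z] := perm_map snd spnz.
    rewrite (perm_hull sX); rewrite (perm_affinely_free sX) in fs.
    have l0E : lift1 0 = c1 *: lift1 a + c2 *: lift1 b.
      by rewrite sE (perm_big _ spnz) /= !big_cons zl addr0.
    have c12 : c1 + c2 = 1.
      by rewrite -s1 (perm_big _ spnz) /= !big_cons z1 addr0.
    have f0b : affinely_free [:: 0, b & Z].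
      apply: (affinely_free_exchange (c := c1) (s := [:: (c2, b)]) fs).
      - by rewrite gt_eqF.
      - by move=> x; rewrite /= !inE => /eqP ->; rewrite eqxx.
      - by rewrite big_seq1.
    have f0a : affinely_free [:: 0, a & Z].
      rewrite affinely_free_swap in fs.
      apply: (affinely_free_exchange (c := c2) (s := [:: (c1, a)]) fs).
      - by rewrite lt_eqF.
      - by move=> x; rewrite /= !inE => /eqP ->; rewrite eqxx.
      - by rewrite big_seq1 addrC.
    have [f [af f0 faZ _]] := affinely_free_dual f0a.
    (* As [c1 + c2 = 1] and [c2 < 0], the vertex [a] lies between the origin and [b]. The simplex on
       [0], [b] and [Z] is cut there, and the given one is a piece of it. *)
    have l01 : 0 < c1^-1 < 1 by rewrite invr_gt0 c10 invf_lt1//; lra.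
    have := @split_hull _ _ Phi 0 b c1^-1 Z f vPhi af l01.
    have -> : c1^-1 *: 0 + (1 - c1^-1) *: b = a.
      rewrite scaler0 add0r (_ : 1 - c1^-1 = c1^-1 * - c2); last first.
        have -> : - c2 = c1 - 1 by lra.
        by field; rewrite gt_eqF.
      have /eq_col_mx[_ E] : col_mx (c1 + c2)%:M (c1 *: a + c2 *: b) = lift1 0.
        by rewrite l0E /lift1 !scale_col_mx add_col_mx !scale_scalar_mx !mulr1 raddfD.
      have {}E : c1 *: a = - (c2 *: b) by apply/eqP; rewrite -addr_eq0 E.
      by rewrite -scalerA scaleNr -E scalerA mulVf ?scale1r// gt_eqF.
    rewrite /= f0 => /(_ ltr01 _ _).
    rewrite !PhiA ?(free_of_affinely_free0 f0a) ?(free_of_affinely_free0 f0b)//.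
    rewrite (PhiB (a :: Z))// ?(free_of_affinely_free0 f0a)// !add0r => -> //.
      by apply: faZ; rewrite mem_head.
    by move=> x xZ; apply: faZ; rewrite inE xZ orbT.
  + have sX : perm_eq (map snd s) (a :: map snd zer) := perm_map snd spnz.
    rewrite (perm_hull sX); rewrite (perm_affinely_free sX) in fs.
    have c11 : c1 = 1 by rewrite -s1 (perm_big _ spnz) /= big_cons z1 addr0.
    have a0 : lift1 a = lift1 0.
      by rewrite sE (perm_big _ spnz) /= big_cons zl addr0 c11 scale1r.
    have {}a0 : a = 0 by have /eq_col_mx[] := a0.
    by rewrite a0 in fs *; apply: PhiA; exact: free_of_affinely_free0 fs.
- exfalso; have : 0 < \sum_(p <- s) p.1 by rewrite s1.
  rewrite ltNge => /negP; apply; rewrite -oppr_ge0 -sumrN (perm_big _ snp) /= big_seq.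
  by apply: sumr_ge0 => p; rewrite mem_filter /= -leNgt oppr_ge0 => /andP[].
Qed.

End Vanishing.

(* [circuit_vanish] shows that [P |-> Phi [v, P]] satisfies the same hypotheses. *)
Lemma valuation_vanish (Phi : polytope R n -> R) : is_valuation Phi ->
  (forall X, X != [::] -> affinely_free X -> Phi (hull X) = 0) -> forall P, Phi P = 0.
Proof.
(* The valuation is quantified inside the induction, because removing a point [v] replaces it by its
   composition with the join. *)
suff H k X Psi : (size X <= k)%N -> X != [::] -> is_valuation Psi ->
    (forall Y, Y != [::] -> affinely_free Y -> Psi (hull Y) = 0) -> Psi (hull X) = 0.
  by move=> vPhi simp P; have [X X0 ->] := polytope_hull P; exact: (H _ X Phi (leqnn _)).
elim: k X Psi => [[]//|k IH] [//|v X] {}Phi Xk _ vPhi simp.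
have [->|X0] := eqVneq X [::].
  apply: simp => //; rewrite /affinely_free /= free_cons nil_free andbT span_nil memv0.
  apply/eqP => /matrixP/(_ (lshift n 0) 0); rewrite col_mxEu !mxE eqxx.
  by move/eqP; rewrite oner_eq0.
rewrite -join_hull//; apply: (IH _ (fun P => Phi (polytope_join v P))) => //.
  exact: polytope_join_valuation.
move=> Y Y0 fY; rewrite join_hull//.
have [fvY|nfvY] := boolP (affinely_free (v :: Y)); first exact: simp.
have vY : lift1 v \in <<in_tuple (map lift1 Y)>>%VS.
  by apply: contraNT nfvY => vY; rewrite /affinely_free/= free_cons vY.
have vE := coord_span vY.
pose s : seq (R * V) := [seq (coord (in_tuple (map lift1 Y)) i (lift1 v), nth 0 Y i)
  | i : 'I_(size (map lift1 Y))].
have sY : map snd s = Y.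
  rewrite -map_comp; apply: (@eq_from_nth _ 0) => [|j].
    exact: etrans (size_map _ _) (etrans (size_enum_ord _) (size_map _ _)).
  rewrite [X in (_ < X)%N -> _](etrans (size_map _ _) (size_enum_ord _)) => j'.
  by rewrite (nth_map (Ordinal j')) ?size_enum_ord//= nth_enum_ord.
have := @circuit_vanish Phi vPhi simp _ s v (leqnn _).
rewrite sY; apply => //.
rewrite big_map big_enum/= [LHS]vE; apply: eq_bigr => i _ /=.
congr (_ *: _); rewrite (nth_map 0)//.
by rewrite -[X in (_ < X)%N](size_map lift1).
Qed.

End Uniqueness.

(** * Cauchy's equation and determinants *)

Section CauchyEquation.
Variable R : realType.

(** The difference [h] from the linear candidate is additive and vanishes at positive rationals.
    Hence [h t = h (t - q)] for rational [q] just below [t], and this is small. *)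
Lemma additive_pos_linear (g : R -> R) :
  (forall s t, 0 < s -> 0 < t -> g (s + t) = g s + g t) ->
  (forall e, 0 < e -> exists2 d, 0 < d & forall t, 0 < t < d -> `|g t| <= e) ->
  forall t, 0 < t -> g t = t * g 1.
Proof.
move=> gD g0; pose h t := g t - t * g 1.
have hD s t : 0 < s -> 0 < t -> h (s + t) = h s + h t.
  by move=> s0 t0; rewrite /h gD//; ring.
have hM k t : 0 < t -> h (k.+1%:R * t) = k.+1%:R * h t.
  move=> t0; elim: k => [|k IH]; first by rewrite !mul1r.
  by rewrite -addn1 natrD !mulrDl !mul1r hD ?mulr_gt0// IH.
have hQ (q : rat) : 0 < q -> h (ratr q) = 0.
  move=> q0; have := numq_gt0 q; rewrite q0 => /esym.
  have := denq_gt0 q; have := divq_num_den q.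
  case: (numq q) (denq q) => [[|m]|]// [[|k]|]// <- _ _.
  have k0 : k.+1%:R != 0 :> R by rewrite pnatr_eq0.
  have E : k.+1%:R * (m.+1%:R / k.+1%:R) = m.+1%:R * 1 :> R by rewrite mulr1 mulrC divfK.
  rewrite fmorph_div /= !ratr_int.
  apply/eqP; rewrite -(mulrI_eq0 _ (mulfI k0)) -hM ?divr_gt0//.
  by rewrite E hM// /h mul1r subrr mulr0.
move=> t t0; apply/eqP; rewrite -subr_eq0 -/(h t) -normr_le0; apply/ler_addgt0Pr => e e0.
rewrite add0r.
have [d d0 gd] := g0 (e / 2) ltac:(by rewrite divr_gt0).
(* One half of [e] is for [g] and one for the linear term; the [+ 1] avoids a zero denominator. *)
pose d' := Num.min d (e / 2 / (`|g 1| + 1)).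
have d'0 : 0 < d' by rewrite lt_min d0 !divr_gt0// ltr_wpDl.
have [|q] := @rat_in_itvoo R (Num.max 0 (t - d')) t.
  by rewrite gt_max t0 ltrBlDr ltrDl.
rewrite in_itv/= gt_max => /andP[/andP[q0 qd] qt].
have q0' : 0 < q by move: q0; rewrite ltr0q.
have tq : 0 < t - ratr q < d' by apply/andP; split; lra.
have /andP[tq0 tqd] := tq.
rewrite -(subrK (ratr q) t) hD// hQ// addr0 /h.
rewrite (le_trans (ler_normB _ _))// [e]splitr lerD//.
  by apply: gd; rewrite tq0 (lt_le_trans tqd)// ge_min lexx.
rewrite normrM (gtr0_norm tq0) (@le_trans _ _ ((t - ratr q) * (`|g 1| + 1)))//.
  by rewrite ler_wpM2l ?(ltW tq0)// lerDl.
rewrite -ler_pdivlMr ?ltr_wpDl//; apply: ltW; apply: (lt_le_trans tqd).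
by rewrite ge_min lexx orbT.
Qed.

End CauchyEquation.

(** * Determinants of lists of vectors and the action of SL(n) *)

Section VolumeForm.
Variables (R : realType) (n : nat).
Local Notation V := 'cV[R]_n.
Implicit Types (X Y : seq V) (x y a b : V).

(** Lists are padded with zero vectors and cut off at [n], so multilinearity holds without size
    conditions. *)
Definition rowsmx X : 'M[R]_n := \matrix_(i, j) X`_i j 0.
Definition volume_form X := \det (rowsmx X).

Lemma volume_form_linear X (i : 'I_n) (c d : R) x y :
  volume_form (set_nth 0 X i (c *: x + d *: y)) =
  c * volume_form (set_nth 0 X i x) + d * volume_form (set_nth 0 X i y).
Proof.
apply: (determinant_multilinear (i0 := i)).
- by apply/matrixP => k j; rewrite !mxE !nth_set_nth/= !eqxx !mxE.
- by apply/matrixP => k j; rewrite !mxE !nth_set_nth/= eq_sym (negbTE (neq_bump _ _)).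
- by apply/matrixP => k j; rewrite !mxE !nth_set_nth/= eq_sym (negbTE (neq_bump _ _)).
Qed.

Lemma free_volume_form X : size X = n -> free X = (volume_form X != 0).
Proof.
move=> Xn; apply/idP/idP.
  move=> /(@freeP _ _ _ (in_tuple X)) fX; apply/det0P => -[v vN v0].
  move/eqP: vN; apply; apply/rowP => i; rewrite mxE.
  have iX : (i < size X)%N by rewrite Xn.
  have := fX (fun k => v 0 (cast_ord Xn k)) _ (Ordinal iX).
  rewrite (_ : cast_ord _ _ = i); last exact: val_inj.
  apply; apply/matrixP => k l; rewrite !ord1 summxE [RHS]mxE.
  have E := v0; move/matrixP/(_ 0 k) : E; rewrite !mxE => E; rewrite -[RHS]E.
  rewrite [RHS](reindex (cast_ord Xn)) /=; last first.
    by exists (cast_ord (esym Xn)) => z _; [exact: cast_ordK|exact: cast_ordKV].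
  by apply: eq_bigr => j _; rewrite !mxE.
move=> d0; apply/(@freeP _ _ _ (in_tuple X)) => k k0 i.
apply: contraNeq d0 => ki; apply/det0P.
exists (\row_j k (cast_ord (esym Xn) j)).
  apply/eqP => /rowP/(_ (cast_ord Xn i)); rewrite !mxE => /eqP.
  by rewrite (_ : cast_ord _ _ = i) ?(negbTE ki)//; exact: val_inj.
apply/rowP => j; rewrite !mxE.
have E := k0; move/matrixP/(_ j 0) : E; rewrite summxE mxE => E; rewrite -[RHS]E.
rewrite [RHS](reindex (cast_ord (esym Xn))) /=; last first.
  by exists (cast_ord Xn) => z _; [exact: cast_ordKV|exact: cast_ordK].
by apply: eq_bigr => l _; rewrite !mxE.
Qed.

Lemma rowsmx_trK X (i : 'I_n) : (rowsmx X)^T *m delta_mx i 0 = X`_i.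
Proof. by apply/matrixP => j k; rewrite -colE !mxE ord1. Qed.

Lemma SL_transitive X Y : size X = n -> size Y = n -> volume_form X = volume_form Y ->
  volume_form X != 0 -> exists2 A : 'M[R]_n, \det A = 1 & Y = map (mulmx A) X.
Proof.
move=> Xn Yn XY X0.
have uX : (rowsmx X)^T \in unitmx by rewrite unitmxE det_tr unitfE.
exists ((rowsmx Y)^T *m invmx (rowsmx X)^T).
  by rewrite det_mulmx det_inv !det_tr -/(volume_form X) -/(volume_form Y) -XY divff.
apply: (@eq_from_nth _ 0); rewrite ?size_map ?Yn// => i iN.
rewrite (nth_map 0) ?Xn// -[i]/(val (Ordinal iN)) -!rowsmx_trK.
by rewrite -mulmxA mulKmx.
Qed.

Lemma free_complete X : free X -> exists Y, free (X ++ Y) /\ size (X ++ Y) = n.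
Proof.
move=> fX; exists (vbasis (<<X>>^C)%VS).
have dX : directv (<<X>> + <<X>>^C) by apply/directv_addP; exact: capv_compl.
have bX : basis_of <<X>>%VS X by rewrite basisEfree fX subvv (eqP fX) leqnn.
have B : basis_of fullv (X ++ vbasis (<<X>>^C)%VS).
  by have := cat_basis dX bX (vbasisP _); rewrite addv_complf.
have /andP[/eqP sB fB] := B; split; first exact: fB.
by rewrite -(eqP fB) sB dimvf /dim/= muln1.
Qed.

(** In a basis extending [X] the last vector is not in [X]; scaling it by [e ^- n.-1] compensates
    the factor [e] on all others. *)
Lemma SL_scale X (e : R) : free X -> (size X < n)%N -> 0 < e ->
  exists2 A : 'M[R]_n, \det A = 1 & forall x, x \in X -> A *m x = e *: x.
Proof.
move=> fX Xn e0; have [Y [fXY XYn]] := free_complete fX.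
set B := X ++ Y in fXY XYn.
have n0 : (0 < n)%N by exact: leq_ltn_trans Xn.
have uB : (rowsmx B)^T \in unitmx.
  by rewrite unitmxE det_tr unitfE -/(volume_form B) -free_volume_form.
have nn : (n.-1 < n)%N by rewrite prednK.
pose d : 'rV[R]_n := \row_j if j == Ordinal nn then e ^- n.-1 else e.
exists ((rowsmx B)^T *m diag_mx d *m invmx (rowsmx B)^T).
  rewrite !det_mulmx det_inv mulrAC mulfV ?mul1r; last first.
    by rewrite -unitfE -unitmxE.
  rewrite det_diag (bigD1 (Ordinal nn))//= mxE eqxx.
  rewrite (eq_bigr (fun=> e)); last by move=> i iN; rewrite mxE (negbTE iN).
  rewrite prodr_const cardC1 card_ord mulVf// expf_eq0 negb_and gt_eqF//.
  by rewrite orbT.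
move=> x /(nthP 0)[i iX <-].
have iB : (i < n)%N by exact: ltn_trans Xn.
have -> : X`_i = B`_(Ordinal iB) by rewrite /B nth_cat iX.
rewrite -rowsmx_trK -!mulmxA mulKmx// -!colE.
have -> : col (Ordinal iB) (diag_mx d) = e *: delta_mx (Ordinal iB) 0.
  apply/matrixP => j k; rewrite !mxE ord1 eqxx andbT.
  case: (eqVneq j (Ordinal iB)) => [->|_]; last by rewrite mulr0.
  rewrite mulr1n mulr1 ifN// -val_eqE/= ltn_eqF//.
  by rewrite (leq_trans iX)// -ltnS prednK.
by rewrite -scalemxAr colE.
Qed.

End VolumeForm.

(** * Values on simplices *)

Section SimplexValues.
Variables (R : realType) (n : nat).
Hypothesis hn : (2 <= n)%N.
Local Notation V := 'cV[R]_n.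
Implicit Types (P Q : polytope R n) (X Y Z T : seq V) (x y a b w : V).

Lemma volume_form_head (c d : R) x y Z :
  volume_form ((c *: x + d *: y) :: Z) = c * volume_form (x :: Z) + d * volume_form (y :: Z).
Proof. exact: (volume_form_linear (0 :: Z) (Ordinal (ltnW hn)) c d x y). Qed.

Lemma volume_form_second (c d : R) z x y Z :
  volume_form [:: z, c *: x + d *: y & Z] =
  c * volume_form [:: z, x & Z] + d * volume_form [:: z, y & Z].
Proof. exact: (volume_form_linear [:: z, 0 & Z] (Ordinal hn) c d x y). Qed.

Lemma volume_form_alternate x Z : volume_form [:: x, x & Z] = 0.
Proof.
apply: (@determinant_alternate _ _ _ (Ordinal (ltnW hn)) (Ordinal hn)) => // j.
by rewrite !mxE.
Qed.

Lemma volume_form_swap x y Z : volume_form [:: y, x & Z] = - volume_form [:: x, y & Z].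
Proof.
have := volume_form_alternate (1 *: x + 1 *: y) Z.
rewrite volume_form_head !volume_form_second !volume_form_alternate => ?; lra.
Qed.

Lemma volume_form_scale (c : R) x Z : volume_form ((c *: x) :: Z) = c * volume_form (x :: Z).
Proof. by have := volume_form_head c 0 x 0 Z; rewrite scale0r addr0 mul0r addr0. Qed.

Lemma volume_form_std : volume_form [seq delta_mx i 0 | i : 'I_n] = 1 :> R.
Proof.
rewrite -[RHS](det1 R n); congr (\det _); apply/matrixP => i j; rewrite !mxE.
rewrite (nth_map i) ?size_enum_ord// nth_ord_enum !mxE eqxx andbT eq_sym.
by [].
Qed.

Lemma exists_volume_form1 : exists a b Z, size [:: a, b & Z] = n /\ volume_form [:: a, b & Z] = 1.
Proof.
have [E [E1 E2]] : exists E : seq V, size E = n /\ volume_form E = 1.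
  exists [seq delta_mx i 0 | i : 'I_n];
  by rewrite size_map size_enum_ord volume_form_std.
by case: E E1 E2 hn => [|a [|b Z]] E1 E2; [rewrite -E1|rewrite -E1|exists a, b, Z].
Qed.

Lemma mulmx_hull (A : 'M[R]_n) X : polytope_mulmx A (hull X) = hull (map (mulmx A) X).
Proof.
apply: polytope_inj; rewrite /= -conv_hull_image; congr conv_hull.
apply/seteqP; split => x /=.
  case: X => [|a X] /= [y + <-]; first by rewrite inE => /eqP ->; rewrite inE mulmx0.
  by move=> yX; rewrite -map_cons map_f.
case: X => [|a X] /=; first by rewrite inE => /eqP ->; exists 0; rewrite ?inE ?mulmx0.
by rewrite -map_cons => /mapP[y yX ->]; exists y.
Qed.

Lemma hausdorff_hull_head x y Z : hausdorff_dist (hull (x :: Z)) (hull (y :: Z)) <= enorm (x - y).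
Proof.
have H u v : forall z, (hull (u :: Z) : set V) z -> dist_to (hull (v :: Z)) z <= enorm (u - v).
  apply: dist_to_hull => z zuZ; have : z \in u :: Z := zuZ.
  rewrite inE => /predU1P[->|zZ].
    by apply: dist_to_le; apply: sub_hull; rewrite mem_head.
  rewrite (dist_to_eq0 _ _).2 ?enorm_ge0//.
  by apply: sub_hull; rewrite inE zZ orbT.
by apply/hausdorff_distP; split=> z; [|rewrite enormBC]; exact: H.
Qed.

Variable Psi : polytope R n -> R.
Hypothesis (cPsi : continuous Psi) (sPsi : SL_invariant Psi) (vPsi : is_valuation Psi).

Lemma continuous_hausdorff P (e : R) : 0 < e ->
  exists2 d, 0 < d & forall Q, hausdorff_dist P Q < d -> `|Psi P - Psi Q| <= e.
Proof.
move=> e0; have := cPsi (nbhsx_ballx (Psi P) e e0).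
move=> /nbhs_ballP[d /= d0 H]; exists d => // Q PQ.
by apply: ltW; apply: (H Q); rewrite ballEmdist.
Qed.

Let c0 := Psi (hull [:: 0]).

(* A simplex in a proper subspace is shrunk to the origin by elements of SL(n). *)
Lemma proper_value X Y : free X -> (size X < n)%N -> Y != [::] ->
  {subset Y <= 0 :: X} -> Psi (hull Y) = c0.
Proof.
move=> fX Xn Y0 YX; apply/eqP; rewrite -subr_eq0 -normr_le0; apply/ler_addgt0Pr => e e0.
rewrite add0r; have [d d0 H] := continuous_hausdorff (hull [:: 0]) e0.
have [M HM] := polytope_enorm_bounded (hull Y).
have M0 : 0 <= M.
  by have [x /HM xM] := polytope_neq0 (hull Y); exact: le_trans (enorm_ge0 x) xM.
(* Shrinking by [s] moves [Y] closer than [d] to the origin; the half makes this strict and the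
   [+ 1] covers [M = 0]. *)
pose s := d / 2 / (M + 1).
have s0 : 0 < s by rewrite !divr_gt0// ltr_wpDl.
have sM : s * M < d.
  rewrite (@le_lt_trans _ _ (d / 2))//; last by lra.
  by rewrite /s mulrAC ler_pdivrMr ?ltr_wpDl// ler_wpM2l ?divr_ge0 ?(ltW d0)// lerDl.
have [A dA AX] := SL_scale fX Xn s0.
have AY y : y \in Y -> A *m y = s *: y.
  by move=> /YX; rewrite inE => /predU1P[->|/AX//]; rewrite mulmx0 scaler0.
rewrite -(sPsi _ dA) distrC; apply: H; apply: le_lt_trans sM.
rewrite mulmx_hull; apply/hausdorff_distP.
have Ay y : y \in Y -> enorm (A *m y) <= s * M.
  move=> yY; rewrite AY// enormZ gtr0_norm// ler_wpM2l ?(ltW s0)//.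
  by apply: HM; exact: sub_hull.
split=> x.
  move=> x0; have -> : x = 0 by move: x0; rewrite hullE set_cons1 conv_hull1.
  case: Y Y0 {YX HM AY} Ay => [//|y Y] _ Ay.
  apply: (@le_trans _ _ (enorm (0 - A *m y))).
    by apply: dist_to_le; apply: sub_hull; rewrite mem_head.
  by rewrite sub0r enormN Ay// mem_head.
move: x; apply: dist_to_hull => x xAY.
have : x \in map (mulmx A) Y by case: (Y) Y0 xAY.
move=> /mapP[y yY ->]; apply: (@le_trans _ _ (enorm (A *m y - 0))).
  by apply: dist_to_le; apply: sub_hull; rewrite mem_head.
by rewrite subr0 Ay.
Qed.

(** With [T] equal to [[::]] or [[:: 0]], one argument treats conv(s) and conv(0,s): linear maps fix
    [T], and hyperplanes through the origin contain it. *)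
Lemma top_value T : (forall x, x \in T -> x = 0) -> exists p, forall X,
  free X -> size X = n -> Psi (hull (X ++ T)) = c0 + p * `|volume_form X|.
Proof.
move=> T0; have [a [b [Z [Zn Z1]]]] := exists_volume_form1.
have mapT A : map (mulmx A) T = T :> seq V.
  by rewrite -[RHS]map_id; apply/eq_in_map => x /T0 ->; rewrite mulmx0.
have valSL X Y : size X = n -> size Y = n -> volume_form X = volume_form Y ->
    volume_form X != 0 -> Psi (hull (X ++ T)) = Psi (hull (Y ++ T)).
  move=> Xn Yn XY X0; have [A dA ->] := SL_transitive Xn Yn XY X0.
  by rewrite -(mapT A) -map_cat -mulmx_hull sPsi// mapT.
pose F t := Psi (hull ([:: t *: a, b & Z] ++ T)).
have vF t : volume_form [:: t *: a, b & Z] = t by rewrite volume_form_scale Z1 mulr1.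
have FE X t : 0 < t -> size X = n -> volume_form X = t -> Psi (hull (X ++ T)) = F t.
  by move=> t0 Xn Xt; apply: valSL => //; rewrite Xt ?vF// gt_eqF.
have sZ : ((size Z).+1 < n)%N by rewrite -[X in (_ < X)%N]Zn.
have proper w : free (w :: Z) -> Psi (hull (w :: Z ++ T)) = c0.
  move=> fw; apply: (proper_value fw) => //.
  move=> x; rewrite !inE mem_cat => /or3P[->|->|/T0 ->]; rewrite ?eqxx ?orbT//.
have FD s t : 0 < s -> 0 < t -> F (s + t) - c0 = (F s - c0) + (F t - c0).
  move=> s0 t0; pose r := s + t; have r0 : 0 < r by rewrite addr_gt0.
  (* The point [w] divides the edge from [a'] to [b] so that the determinant [r] splits into [t] and
     [s]. *)
  pose a' := r *: a; pose l := s / r.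
  have l1 : 1 - l = t / r by rewrite /l /r; field; rewrite gt_eqF.
  have l01 : 0 < l < 1 by rewrite divr_gt0//= -subr_gt0 l1 divr_gt0.
  pose w := l *: a' + (1 - l) *: b.
  have fab : free [:: a', b & Z] by rewrite (@free_volume_form _ _ [:: a', b & Z] Zn) vF gt_eqF.
  have fba : free [:: b, a' & Z] by rewrite (@free_volume_form _ _ [:: b, a' & Z] Zn) volume_form_swap vF oppr_eq0 gt_eqF.
  have vwb : volume_form [:: w, b & Z] = s.
    by rewrite volume_form_head volume_form_alternate vF mulr0 addr0 /l divfK// gt_eqF.
  have vaw : volume_form [:: a', w & Z] = t.
    by rewrite volume_form_second volume_form_alternate vF mulr0 add0r l1 divfK// gt_eqF.
  have fwZ : free (w :: Z).
    have : free [:: a', w & Z] by rewrite (@free_volume_form _ _ [:: a', w & Z] Zn) vaw gt_eqF.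
    by rewrite free_cons => /andP[].
  have [f [fa fbZ]] := free_dual fab; have [g [gb gaZ]] := free_dual fba.
  have fb : f b = 0 by apply: fbZ; rewrite mem_head.
  have ga : g a' = 0 by apply: gaZ; rewrite mem_head.
  (* Vanishes at [w] and on [Z], and at [0] because it is linear, hence on [T]. *)
  pose h x : R := (1 - l) * f x - l * g x.
  have ah : affine h.
    have af (phi : {linear V -> R^o}) : affine phi.
      by move=> u x y; rewrite linearD !linearZ.
    by move=> u x y; rewrite /h !af; ring.
  have /andP[l0 l1'] := l01.
  have ha : 0 < h a' by rewrite /h fa ga mulr1 mulr0 subr0 subr_gt0.
  have hw : h w = 0 by rewrite ah /h fa fb ga gb; ring.
  have hX x : x \in Z ++ T -> h x = 0.
    rewrite mem_cat => /orP[xZ|/T0 ->]; rewrite /h ?linear0 ?mulr0 ?subr0//.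
    by rewrite fbZ ?gaZ ?inE ?xZ ?orbT// !mulr0 subr0.
  have := @split_hull _ _ Psi a' b l (Z ++ T) h vPsi ah l01.
  rewrite /= -/w => /(_ ha hw hX); rewrite proper// -!cat_cons.
  rewrite (FE [:: a', w & Z] t)// (FE [:: w, b & Z] s)// -/(F r) => ?; rewrite -/r; lra.
(* As [t] tends to 0 the vertex [t *: a] tends to the origin, and the limit body lies in a proper
   subspace. *)
have Flim e : 0 < e -> exists2 d, 0 < d & forall t, 0 < t < d -> `|F t - c0| <= e.
  move=> e0; have [d d0 H] := continuous_hausdorff (hull [:: 0, b & Z ++ T]) e0.
  exists (d / (enorm a + 1)); first by rewrite divr_gt0// ltr_wpDl// enorm_ge0.
  move=> t /andP[t0 td].
  have fbZ : free (b :: Z).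
    have : free [:: a, b & Z] by rewrite (free_volume_form Zn) Z1 oner_eq0.
    by rewrite free_cons => /andP[].
  rewrite -(@proper_value (b :: Z) [:: 0, b & Z ++ T])//; last first.
    move=> x; rewrite !inE mem_cat => /or4P[->|->|->|/T0 ->]; rewrite ?eqxx ?orbT//.
  rewrite distrC; apply: H; apply: le_lt_trans (hausdorff_hull_head _ _ _) _.
  rewrite sub0r enormN enormZ gtr0_norm// (@le_lt_trans _ _ (t * (enorm a + 1)))//.
    by rewrite ler_wpM2l ?(ltW t0)// lerDl.
  by rewrite -ltr_pdivlMr// ltr_wpDl// enorm_ge0.
have Flin t : 0 < t -> F t = c0 + (F 1 - c0) * t.
  by move=> t0; have := additive_pos_linear FD Flim t0 => ?; lra.
exists (F 1 - c0) => X fX Xn.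
have := fX; rewrite (free_volume_form Xn) neq_lt => /orP[X0|X0]; last first.
  by rewrite gtr0_norm// -Flin//; exact: FE.
rewrite ltr0_norm// -Flin ?oppr_gt0//.
(* Exchanging two vectors makes the determinant positive without changing the hull; here two vectors
   exist because [n] is at least 2. *)
case: X fX Xn X0 => [|x [|y X]] fX Xn X0; [by move: (hn); rewrite -[X in (_ <= X)%N]Xn|by move: (hn); rewrite -[X in (_ <= X)%N]Xn|].
have -> : hull ([:: x, y & X] ++ T) = hull ([:: y, x & X] ++ T).
  by apply: eq_hull => z; rewrite !inE orbCA.
by apply: FE; rewrite ?oppr_gt0// volume_form_swap.
Qed.

End SimplexValues.

(** * The classification *)

Section SimplexVolumes.
Variables (R : realType) (n : nat).
Hypothesis hn : (2 <= n)%N.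
Local Notation V := 'cV[R]_n.
Implicit Types (X Y Z : seq V) (x y a b w : V).

Lemma V_n_hull_translate X v : X != [::] ->
  V_n (hull (map (fun x => x + v) X)) = V_n (hull X).
Proof.
move=> X0; congr fine.
rewrite -(lebesgue_volume_translate v (polytope_measurable _)).
congr lebesgue_volume; apply/seteqP; split => x /=.
  suff H : hull (map (fun x => x + v) X) `<=` [set y | (hull X : set V) (y - v)].
    by move=> /H /=; rewrite addrK.
  apply: hull_sub; first by case: (X) X0.
    apply/convex_setP => y z t /= Xy Xz t01.
    have /convex_setP := @polytope_convex _ _ (hull X).
    move=> /(_ _ _ _ Xy Xz t01); congr (polytope_set _ _).
    by apply/matrixP => i j; rewrite !mxE; ring.
  by move=> _ /mapP[y yX ->] /=; rewrite addrK; exact: sub_hull.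
move: x; apply: (@hull_sub _ _ X [set x | (hull (map (fun x => x + v) X) : set V) (x + v)]) => //.
  apply/convex_setP => y z t /= Xy Xz t01.
  have /convex_setP := @polytope_convex _ _ (hull (map (fun x => x + v) X)).
  move=> /(_ _ _ _ Xy Xz t01); congr (polytope_set _ _).
  by apply/matrixP => i j; rewrite !mxE; ring.
by move=> y yX; apply: sub_hull; exact: map_f.
Qed.

Lemma free_sub_head a X : free (a :: X) -> free (map (fun x => x - a) X).
Proof.
move=> /free_pairsP H; apply/free_pairsP => t tX t0 p pt.
apply: (H ((- \sum_(q <- t) q.1, a) :: [seq (q.1, q.2 + a) | q <- t]) _ _ (p.1, p.2 + a)).
- rewrite /= -map_comp; congr (_ :: _).
  rewrite (_ : map _ t = map (fun x => x + a) (map snd t)); last by rewrite -map_comp.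
  by rewrite tX -map_comp -[RHS]map_id; apply: eq_map => x /=; rewrite subrK.
- rewrite big_cons big_map /=.
  rewrite [X in _ + X](eq_bigr (fun q => q.1 *: q.2 + q.1 *: a)) => [|q _]; last by rewrite scalerDr.
  by rewrite big_split/= t0 add0r -scaler_suml scaleNr addNr.
- by rewrite inE; apply/orP; right; apply/mapP; exists p.
Qed.

Lemma V_n_hull0 : V_n (hull [:: 0 : V]) = 0.
Proof.
rewrite /V_n (_ : polytope_set _ = box 0 0).
  by rewrite lebesgue_volume_box// subrr expr0n/= gtn_eqF// (leq_trans _ hn).
rewrite hullE set_cons1 conv_hull1; apply/seteqP; split => x /= => [-> i|H].
  by rewrite mxE lexx.
by apply/matrixP => i j; rewrite ord1 mxE; apply/eqP; rewrite eq_le andbC H.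
Qed.

(** Volume is itself a functional covered by [top_value], which supplies [k]. It is positive because
    the standard simplex contains a cube of side [n%:R^-1]. *)
Lemma V_n_simplex : exists2 k : R, 0 < k & forall X, free X -> size X = n ->
  V_n (hull (0 :: X)) = k * `|volume_form X|.
Proof.
have T0 x : x \in [:: 0 : V] -> x = 0 by rewrite inE => /eqP.
have [k kP] := top_value hn (@V_n_continuous R n) (@V_n_SL_invariant R n)
  (@V_n_valuation R n) T0.
have {}kP X : free X -> size X = n -> V_n (hull (0 :: X)) = k * `|volume_form X|.
  move=> fX Xn; rewrite -[RHS]add0r -V_n_hull0 -kP//; congr V_n; congr polytope_set.
  by apply: eq_hull => x; rewrite mem_cat inE [in RHS]inE orbC.
exists k => //; pose E : seq V := [seq delta_mx i 0 | i : 'I_n].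
have En : size E = n by rewrite size_map size_enum_ord.
have E1 : volume_form E = 1 := volume_form_std R n.
have fE : free E by rewrite free_volume_form// E1 oner_eq0.
have := kP E fE En; rewrite E1 normr1 mulr1 => <-.
have n0 : (0 : R) < n%:R by rewrite ltr0n (leq_trans _ hn).
rewrite -lte_fin V_nK; apply: (@lt_le_trans _ _ (lebesgue_volume (box 0 n%:R^-1 : set V))).
  by rewrite lebesgue_volume_box ?subr0 ?lte_fin ?exprn_gt0 ?invr_gt0// invr_ge0 ltW.
apply: (@le_measure _ _ _ (@volume R n)); rewrite ?inE//.
- exact: measurable_box.
- exact: polytope_measurable.
move=> x xb.
have -> : x = \sum_(p <- (1 - \sum_i x i 0, 0) :: [seq (x i 0, delta_mx i 0) | i : 'I_n]) p.1 *: p.2.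
  rewrite big_cons scaler0 add0r big_map big_enum/= [LHS]matrix_sum_delta.
  by apply: eq_bigr => i _; rewrite big_ord1.
apply: convex_comb.
- exact: polytope_convex.
- move=> p; rewrite inE => /predU1P[->|/mapP[i _ ->]] /=; split.
  + rewrite subr_ge0 (@le_trans _ _ (\sum_(i < n) n%:R^-1))//.
      by apply: ler_sum => i _; have /andP[] := xb i.
    by rewrite sumr_const card_ord -[_ *+ _]mulr_natr mulVf// gt_eqF.
  + by apply: (@sub_hull _ _ (0 :: E) 0); rewrite mem_head.
  + by have /andP[] := xb i.
  + by apply: (@sub_hull _ _ (0 :: E) (delta_mx i 0)); rewrite inE; apply/orP; right; apply/mapP; exists i; rewrite ?mem_enum.
- by rewrite big_cons big_map big_enum/= subrK.
Qed.

Lemma V_n_proper X Y : free X -> (size X < n)%N -> Y != [::] ->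
  {subset Y <= 0 :: X} -> V_n (hull Y) = 0.
Proof.
move=> fX Xn Y0 YX; rewrite -V_n_hull0.
exact: (proper_value (@V_n_continuous R n) (@V_n_SL_invariant R n) fX).
Qed.

(** Translating one vertex to the origin puts the others into a proper subspace. *)
Lemma V_n_facet X : free X -> size X = n -> V_n (hull X) = 0.
Proof.
case: X => [|a X] fX Xn; first by move: (hn); rewrite -[X in (_ <= X)%N]Xn.
rewrite -(V_n_hull_translate (- a))// map_cons subrr.
apply: (V_n_proper (free_sub_head fX)) => //.
by rewrite size_map -[X in (_ < X)%N]Xn.
Qed.

End SimplexVolumes.

Theorem corollary2p3 (R : realType) (n : nat) (hn : (2 <= n)%N)
    (Psi : polytope R n -> R) :
  [/\ continuous Psi, SL_invariant Psi & is_valuation Psi] <->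
  exists c0 cn dn : R, forall P : polytope R n,
    Psi P = c0 * V_0 P + cn * V_n P + dn * V_n (conv_hull (0 |` P)).
Proof.
split=> [[cPsi sPsi vPsi]|[c0 [cn [dn]]]]; last exact: volume_combination_valuation.
have [p pP] := top_value hn cPsi sPsi vPsi
  (T := [:: 0]) (fun x => ltac:(by rewrite inE => /eqP)).
have [q qP] := top_value hn cPsi sPsi vPsi (T := [::]) (fun x => ltac:(by [])).
have [k k0 kP] := V_n_simplex R hn.
set c0 := Psi (hull [:: 0]) in pP qP.
(* On conv(s) volume vanishes and the join has volume [k] times |det s|, so [k * dn = q]. On
   conv(0,s) both volumes are [k] times |det s|, so [k * (cn + dn) = p]. *)
exists c0, ((p - q) / k), (q / k).
pose Phi P := Psi P - (c0 * V_0 P + (p - q) / k * V_n P + q / k * V_n (polytope_join 0 P)).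
suff Phi0 : forall P, Phi P = 0.
  by move=> P; apply/eqP; rewrite -subr_eq0; apply/eqP; exact: Phi0.
have vPhi : is_valuation Phi.
  have [_ _ vC] := @volume_combination_valuation R n c0 ((p - q) / k) (q / k) _ (fun=> erefl).
  move=> P Q U I UPQ IPQ; have := vC P Q U I UPQ IPQ; have := vPsi P Q U I UPQ IPQ.
  by rewrite /Phi => ? ?; lra.
apply: (valuation_vanish vPhi).
have le_size (X : seq 'cV[R]_n) : free X -> (size X <= n)%N.
  move=> fX; rewrite -(eqP fX); apply: leq_trans (dimvS (subvf _)) _.
  by rewrite dimvf /dim/= muln1.
have hull00 (X : seq 'cV[R]_n) : hull [:: 0, 0 & X] = hull (0 :: X).
  by apply: eq_hull => x; rewrite !inE orbA orbb.
apply: (simplex_vanish vPhi).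
- move=> X fX; rewrite /Phi join_hull// hull00 /V_0.
  have := le_size X fX; rewrite leq_eqVlt => /predU1P[Xn|Xn].
    rewrite kP// (_ : hull (0 :: X) = hull (X ++ [:: 0])) ?pP//.
      by field; rewrite gt_eqF.
    by apply: eq_hull => x; rewrite mem_cat inE [in RHS]inE orbC.
  rewrite (V_n_proper hn fX Xn)// (proper_value cPsi sPsi fX)// -/c0; ring.
- move=> X X0 fX; rewrite /Phi join_hull// /V_0.
  have := le_size X fX; rewrite leq_eqVlt => /predU1P[Xn|Xn].
    rewrite kP// V_n_facet// -[X in hull X]cats0 qP//.
    by field; rewrite gt_eqF.
  have XX : {subset X <= 0 :: X} by move=> x xX; rewrite inE xX orbT.
  by rewrite !(V_n_proper hn fX Xn)// (proper_value cPsi sPsi fX Xn X0 XX) -/c0; ring.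
Qed.
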